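(* Let $N\in\mathbb{N}$, $\mathbf{r}=(r_1,\dots,r_{N-1})\in\mathbb{N}^{N-1}$, $\mathrm{wt}(\mathbf{r})=\sum_{i=1}^{N-1}r_i$ and $I_{N-1}=\{1,2,\dots,N-1\}$. Then for $s\in\mathbb{C}$ (as an identity of meromorphic functions of $s$ on $\mathbb{C}$), $$\sum_{n=0}^{N-1}(-1)^n\sum_{\substack{J\subset I_{N-1}\\ \sharp J=n}}\left\{\prod_{j\in I_{N-1}\setminus J}\zeta_{MT,r_j}(\{1\}^{r_j};1)\right\}\xi_{MT,n}\big(\{\mathbf{1}_{r_j+1}\mid j\in J\};s\big)$$ $$=\sum_{n=0}^{\mathrm{wt}(\mathbf{r})}(s)_n\sum_{\substack{i_1+\cdots+i_{N-1}=n\\ 0\le i_l\le r_l}}\left\{\prod_{j=1}^{N-1}\binom{r_j}{i_j}(r_j-i_j)!\right\}\zeta_{MT,N}(r_1-i_1+1,\,r_2-i_2+1,\dots,r_{N-1}-i_{N-1}+1,\,0;\,s+n).$$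
   Context: $\mathbb{N}=\{1,2,3,\dots\}$, $\mathbb{N}_0=\mathbb{N}\cup\{0\}$. $\{1\}^{n}$ denotes $n$ repetitions of $1$, and $\mathbf{1}_{r+1}=(\{1\}^{r+1})\in\mathbb{N}^{r+1}$. $(s)_n=s(s+1)\cdots(s+n-1)$ is the Pochhammer symbol, $(s)_0=1$. Empty products equal $1$. For $\Bbbk=(k_1,\dots,k_{r+1})\in\mathbb{N}^r\times\mathbb{N}_0$ and $|z|<1$, $$\mathcal{L}_{\Bbbk}(z)=\sum_{m_1,\dots,m_r=1}^\infty\frac{z^{m_1+\cdots+m_r}}{m_1^{k_1}\cdots m_r^{k_r}(m_1+\cdots+m_r)^{k_{r+1}}}.$$ For $g,\rho_1,\dots,\rho_g\in\mathbb{N}$, $\Bbbk_i\in\mathbb{N}^{\rho_i}\times\mathbb{N}_0$ $(1\le i\le g)$ and $\Re(s)>1-\sum_{i=1}^g\rho_i$, $$\xi_{MT,g}(\Bbbk_1,\dots,\Bbbk_g;s)=\frac{1}{\Gamma(s)}\int_0^\infty\frac{t^{s-1}}{e^t-1}\prod_{i=1}^g\mathcal{L}_{\Bbbk_i}(1-e^{-t})\,dt;$$ it continues analytically to an entire function of $s$, denoted by the same symbol. It is symmetric in $\Bbbk_1,\dots,\Bbbk_g$, and $\xi_{MT,n}(\{\mathbf{1}_{r_j+1}\mid j\in J\};s)$ means $\xi_{MT,n}$ evaluated at the family of indices $\mathbf{1}_{r_j+1}$, $j\in J$ (with repetition allowed). For $J=\emptyset$ one sets $\xi_{MT,0}(\emptyset;s)=\zeta(s)$,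 the Riemann zeta function. The Mordell-Tornheim $n$-ple zeta function is $$\zeta_{MT,n}(s_1,\dots,s_n;s_{n+1})=\sum_{m_1,\dots,m_n=1}^\infty\frac{1}{m_1^{s_1}\cdots m_n^{s_n}(m_1+\cdots+m_n)^{s_{n+1}}}$$ where the series converges absolutely; it continues meromorphically to $\mathbb{C}^{n+1}$. With $s_1,\dots,s_n$ fixed to be nonnegative integers, the series converges absolutely when $\Re(s_{n+1})>n$, and $\zeta_{MT,n}$ is understood, as a function of $s_{n+1}$, as the meromorphic continuation to $\mathbb{C}$. When $N=1$, $\mathbf{r}$ is empty, and the right-hand side is the single term $\zeta_{MT,1}(0;s)$. *)

(* Defs.v *)
From HB Require Import structures.
From mathcomp Require Export all_boot all_order all_algebra.
From mathcomp Require Export complex.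
From mathcomp Require Export finmap.
From mathcomp Require Export all_classical all_reals all_analysis.
From mathcomp Require summability.

#[export] Set Implicit Arguments.
#[export] Unset Strict Implicit.
#[export] Unset Printing Implicit Defensive.

Export numFieldNormedType.Exports.
Import Order.TTheory GRing.Theory Num.Theory.

Local Open Scope classical_set_scope.
Local Open Scope ring_scope.
Local Open Scope complex_scope.

(* Unconditional (equivalently, absolutely convergent) sum of a family of
   scalars: the limit of its finite partial sums along the directed set of
   finite subsets of I; unspecified when the limit does not exist. *)
Definition usum (K : numFieldType) (I : choiceType) (x : I -> K) : K :=
  @summability.sum I K K^o x.

(* Analytic means locally the sum of a convergent power series. *)
Definition analytic_at (K : numFieldType) (f : K -> K) (z0 : K) : Prop :=
  exists a : nat -> K,
    \forall z \near z0, series (fun n => a n * (z - z0) ^+ n) @ \oo --> f z.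

Definition pole_at (K : numFieldType) (f : K -> K) (z0 : K) : Prop :=
  exists (m : nat) (g : K -> K),
    [/\ (0 < m)%N, analytic_at g z0, g z0 != 0 &
        \forall z \near z0^', f z = g z / (z - z0) ^+ m].

Definition entire (K : numFieldType) (f : K -> K) : Prop :=
  forall z, analytic_at f z.

(* The value of f at a pole is irrelevant. *)
Definition meromorphic (K : numFieldType) (f : K -> K) : Prop :=
  forall z, analytic_at f z \/ pole_at f z.

(* Equality of meromorphic functions on K: every point has a punctured
   neighbourhood on which the two functions agree.  By continuity they then
   have the same value wherever both are analytic. *)
Definition mero_eq (K : numFieldType) (f g : K -> K) : Prop :=
  forall z0, \forall z \near z0^', f z = g z.

Definition poch (K : pzRingType) (s : K) (n : nat) : K :=
  \prod_(0 <= i < n) (s + i%:R).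

Local Notation Re := complex.Re.
Local Notation Im := complex.Im.

Section ComplexFunctions.
Variable R : realType.
Implicit Types (s z : R[i]) (t x : R) (n : nat).

(* x ^ s = exp (s log x); only used for 0 < x. *)
Definition cpow x s : R[i] :=
  (x `^ Re s)%:C * (cos (Im s * ln x) +i* sin (Im s * ln x)).

Definition cint0oo (f : R -> R[i]) : R[i] :=
  (\int[lebesgue_measure]_(t in `]0%R, +oo[) Re (f t)) +i*
  (\int[lebesgue_measure]_(t in `]0%R, +oo[) Im (f t)).

(* Euler's integral, meaningful for 0 < Re s. *)
Definition Gamma_euler s : R[i] :=
  cint0oo (fun t => cpow t (s - 1) * (expR (- t))%:C).

(* Gamma on the whole plane, through Gamma(s) = Gamma(s + n) / (s)_n with n
   chosen so that 0 < Re (s + n).  At the poles s = 0, -1, -2, ... one has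
   (s)_n = 0, hence Gamma s = 0 and (Gamma s)^-1 = 0, which is the correct value
   of the entire function 1 / Gamma. *)
Definition Gamma s : R[i] :=
  let n := if 0 < Re s then 0%N else (Num.truncn (- Re s)).+1 in
  Gamma_euler (s + n%:R) / poch s n.

(* In the multiple sums below, m : {ffun 'I_n -> nat} encodes the tuple of
   positive integers (m i).+1. *)

(* zeta_{MT,n}(k_1, ..., k_n; s) with n = size k, as a series. *)
Definition zetaMT_series (k : seq nat) s : R[i] :=
  usum (fun m : {ffun 'I_(size k) -> nat} =>
    ((\prod_i (m i).+1%:R ^+ nth 0%N k i) *
     cpow (\sum_i (m i).+1)%N%:R s)^-1).

(* Meromorphic continuation in s of zeta_{MT,n}(k_1, ..., k_n; s) to C. *)
Definition is_zetaMT (k : seq nat) (Z : R[i] -> R[i]) : Prop :=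
  meromorphic Z /\
  forall s, (size k)%:R < Re s -> Z s = zetaMT_series k s.

Definition is_riemann_zeta (Z : R[i] -> R[i]) : Prop :=
  meromorphic Z /\
  forall s, 1 < Re s -> Z s = usum (fun n : nat => (cpow n.+1%:R s)^-1).

(* An index (k_1, ..., k_rho, k_{rho+1}) in N^rho x N_0 is the pair
   ([:: k_1; ...; k_rho], k_{rho+1}). *)
Definition mt_index : Type := (seq nat * nat)%type.

Definition mt_index_valid (k : mt_index) : bool :=
  (0 < size k.1)%N && all (fun i => 0 < i)%N k.1.

Definition ones_index (n : nat) : mt_index := (nseq n 1%N, 1%N).

Definition L_MT (k : mt_index) z : R[i] :=
  usum (fun m : {ffun 'I_(size k.1) -> nat} =>
    z ^+ (\sum_i (m i).+1)%N /
    ((\prod_i (m i).+1%:R ^+ nth 0%N k.1 i) *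
     (\sum_i (m i).+1)%N%:R ^+ k.2)).

Definition xiMT_integral (ks : seq mt_index) s : R[i] :=
  (Gamma s)^-1 *
  cint0oo (fun t => cpow t (s - 1) / (expR t - 1)%:C *
                    \prod_(k <- ks) L_MT k (1 - expR (- t))%:C).

(* xi_{MT,g} with g = size ks; by convention it is zeta when g = 0. *)
Definition is_xiMT (ks : seq mt_index) (X : R[i] -> R[i]) : Prop :=
  if ks is [::] then is_riemann_zeta X
  else entire X /\
       forall s, 1 - (\sum_(k <- ks) size k.1)%N%:R < Re s ->
         X s = xiMT_integral ks s.

End ComplexFunctions.

(* Main.v *)
Require Import Defs.
From mathcomp Require Import ring measurable_realfun.
Import Order.TTheory GRing.Theory Num.Theory.
Local Open Scope classical_set_scope.
Local Open Scope ring_scope.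
Local Open Scope complex_scope.

(** Let x = 1 - exp (- t).  The derivative of L_(1,..,1;1) (r ones before the
semicolon) at x is (- log (1 - x))^r / x = t^r / x, and dx = exp (- t) dt, so
that, as t grows to infinity, the distance of L(x) to its limit
zeta_(MT,r)(1,..,1;1) is the integral of u^r / (exp u - 1) over [t, oo[.
Expanding 1 / (exp u - 1) in powers of exp (- u) and integrating term by term,
this tail is the finite sum over i <= r of

  C(r, i) (r - i)! t^i Li_(r-i+1)(exp (- t)).

The product over j of these equalities for r = r_j is integrated against
t^(s-1) / (exp t - 1).  Expanding the product of the differences
zeta_(MT,r_j) - L_j over the subsets J gives Gamma(s) times the left-hand side.
Expanding the product of the closed forms over the tuples (i_j), each term is
the Mellin transform of t^n times a product of N polylogarithms, which is
Gamma(s + n) = (s)_n Gamma(s) times a value of zeta_MT, so that one obtains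
Gamma(s) times the right-hand side.

This computation is done for real s > N + 2 only.  There the integrands and the
terms of the series are nonnegative reals, multiple series are limits of their
truncations to boxes [0, M)^n, a truncation of a product is a product of
truncations, and all exchanges of limits and integrals are instances of monotone
convergence.  The main steps are [integral_MTtail] and [cvg_MTterm] (the two
forms of the tail), [cvg_boxsum_mellin] (the Mellin transform), [sum_Lprod] and
[sum_Liprod] (the two expansions).

Real s are enough, by [mero_eq_of_real_half_line]: near each point of the plane
the difference of two meromorphic functions either vanishes on a punctured
neighbourhood or has no zero on one.  Both kinds of points form open sets, so
by connectedness only one kind exists, and zeros at all large real s exclude
the second. *)

(** * Germs of meromorphic functions *)

Section GermDichotomy.
Variable K : numFieldType.
Implicit Types (f g : K -> K) (z w : K).

(** Regular points and poles are treated alike, and the exponent [m] need not be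
the order of the pole: sums are then handled by a common exponent, whatever
cancels. *)
Definition mero_at f z0 :=
  exists m g, analytic_at g z0 /\
    \forall z \near z0^', f z * (z - z0) ^+ m = g z.

Lemma meromorphic_mero_at f z0 : meromorphic f -> mero_at f z0.
Proof.
move=> /(_ z0)[fz0|[m [g [m0 gz0 _ fE]]]].
  exists 0%N, f; split=> //; near=> z.
  by rewrite expr0 mulr1.
exists m, g; split=> //; near=> z.
have zz0 : z != z0 by near: z; exact: nbhs_dnbhs_neq.
have -> : f z = g z / (z - z0) ^+ m by near: z.
by rewrite divfK // expf_neq0 // subr_eq0.
Unshelve. all: by end_near. Qed.

Lemma analytic_atD f g z0 :
  analytic_at f z0 -> analytic_at g z0 -> analytic_at (fun z => f z + g z) z0.
Proof.
move=> [a fa] [b gb]; exists (fun n => a n + b n); near=> z.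
rewrite (_ : series _ = fun N => series (fun n => a n * (z - z0) ^+ n) N +
                                 series (fun n => b n * (z - z0) ^+ n) N).
  by apply: cvgD; near: z.
by apply/funext => n; rewrite /series /= -big_split; apply: eq_bigr => i _; rewrite mulrDl.
Unshelve. all: by end_near. Qed.

Lemma analytic_atZ f z0 c : analytic_at f z0 -> analytic_at (fun z => c * f z) z0.
Proof.
move=> [a fa]; exists (fun n => c * a n); near=> z.
rewrite (_ : series _ = fun n => c * series (fun n => a n * (z - z0) ^+ n) n).
  by apply: cvgMr; near: z.
by apply/funext => n; rewrite /series /= mulr_sumr; apply: eq_bigr => i _; rewrite mulrA.
Unshelve. all: by end_near. Qed.

Lemma analytic_atMX f z0 : analytic_at f z0 ->
  analytic_at (fun z => (z - z0) * f z) z0.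
Proof.
move=> [a fa]; exists (fun n => if n is n'.+1 then a n' else 0); near=> z.
rewrite -cvg_shiftS.
rewrite (_ : [sequence _]_n =
             fun n => (z - z0) * series (fun n => a n * (z - z0) ^+ n) n).
  by apply: cvgMr; near: z.
apply/funext => n; rewrite /series /= big_nat_recl // mul0r add0r mulr_sumr.
by apply: eq_bigr => i _; rewrite exprS mulrCA.
Unshelve. all: by end_near. Qed.

Lemma analytic_atMXn f z0 m : analytic_at f z0 ->
  analytic_at (fun z => (z - z0) ^+ m * f z) z0.
Proof.
move=> fa; elim: m => [|m IH].
  by rewrite (_ : (fun _ => _) = f) //; apply/funext => z; rewrite expr0 mul1r.
rewrite (_ : (fun _ => _) = (fun z => (z - z0) * ((z - z0) ^+ m * f z))).
  exact: analytic_atMX.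
by apply/funext => z; rewrite exprS mulrA.
Qed.

Lemma analytic_at0 z0 : analytic_at (fun=> 0) z0.
Proof.
exists (fun=> 0); near=> z.
rewrite (_ : series _ = fun=> 0); first exact: cvg_cst.
by apply/funext => n; rewrite /series /= big1 // => i _; rewrite mul0r.
Unshelve. all: by end_near. Qed.

Lemma mero_at0 z0 : mero_at (fun=> 0) z0.
Proof.
exists 0%N, (fun=> 0); split; first exact: analytic_at0.
by near=> z; rewrite mul0r.
Unshelve. all: by end_near. Qed.

Lemma mero_atD f g z0 : mero_at f z0 -> mero_at g z0 ->
  mero_at (fun z => f z + g z) z0.
Proof.
move=> [m [p [pa fp]]] [n [q [qa gq]]].
exists (m + n)%N, (fun z => (z - z0) ^+ n * p z + (z - z0) ^+ m * q z).
split; first by apply: analytic_atD; apply: analytic_atMXn.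
near=> z.
have <- : f z * (z - z0) ^+ m = p z by near: z.
have <- : g z * (z - z0) ^+ n = q z by near: z.
by rewrite exprD; ring.
Unshelve. all: by end_near. Qed.

Lemma mero_atZ f z0 c : mero_at f z0 -> mero_at (fun z => c * f z) z0.
Proof.
move=> [m [p [pa fp]]]; exists m, (fun z => c * p z).
split; first exact: analytic_atZ.
near=> z.
have <- : f z * (z - z0) ^+ m = p z by near: z.
by rewrite mulrA.
Unshelve. all: by end_near. Qed.

Lemma mero_atMX f z0 c : mero_at f z0 -> mero_at (fun z => (z + c) * f z) z0.
Proof.
move=> [m [p [pa fp]]]; exists m, (fun z => (z - z0) * p z + (z0 + c) * p z).
split; first by apply: analytic_atD; [exact: analytic_atMX|exact: analytic_atZ].
near=> z.
have <- : f z * (z - z0) ^+ m = p z by near: z.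
by ring.
Unshelve. all: by end_near. Qed.

Lemma mero_at_sum (I : Type) (r : seq I) (P : pred I) (F : I -> K -> K) z0 :
  (forall i, P i -> mero_at (F i) z0) -> mero_at (fun z => \sum_(i <- r | P i) F i z) z0.
Proof.
move=> Fa; elim: r => [|i r IH].
  rewrite (_ : (fun _ => _) = fun=> 0); first exact: mero_at0.
  by apply/funext => z; rewrite big_nil.
case Pi : (P i); last first.
  rewrite (_ : (fun _ => _) = fun z => \sum_(i <- r | P i) F i z) //.
  by apply/funext => z; rewrite big_cons Pi.
rewrite (_ : (fun _ => _) = fun z => F i z + \sum_(i <- r | P i) F i z).
  exact: (mero_atD (Fa _ Pi) IH).
by apply/funext => z; rewrite big_cons Pi.
Qed.

Lemma mero_at_poch f z0 n : mero_at f z0 -> mero_at (fun z => poch z n * f z) z0.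
Proof.
move=> fa; elim: n => [|n IH].
  by rewrite (_ : (fun _ => _) = f) //; apply/funext => z; rewrite /poch big_nil mul1r.
rewrite (_ : (fun _ => _) = fun z => (z + n%:R) * (poch z n * f z)).
  exact: mero_atMX.
by apply/funext => z; rewrite /poch big_nat_recr //= -mulrA mulrCA.
Qed.

Lemma mero_at_shift f z0 c : mero_at f (z0 + c) -> mero_at (fun z => f (z + c)) z0.
Proof.
have shE (x y : K) : x + c - (y + c) = x - y by ring.
move=> [m [p [[a pa] fp]]]; exists m, (fun z => p (z + c)); split.
  exists a; move: pa => /nbhs_normP[e /= e0 pa]; apply/nbhs_normP; exists e => //= z zz0.
  by have := pa (z + c); rewrite /ball_ /= !shE => /(_ zz0).
move: fp => /nbhs_normP[e /= e0 fp]; apply/nbhs_normP; exists e => //= z zz0 nz.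
have := fp (z + c); rewrite /ball_ /= !shE => /(_ zz0); apply.
by apply: contra nz => /eqP/addIr ->.
Qed.

(** Zeros of a power series are isolated: if a_k is the first nonzero coefficient,
the term a_k (z - z0)^k dominates the later ones near [z0].  The partial sums
are bounded below by comparison with a geometric series, uniformly in their
length, and the bound passes to the limit. *)
Lemma analytic_at_dichotomy g z0 : analytic_at g z0 ->
  (\forall z \near z0^', g z = 0) \/ (\forall z \near z0^', g z != 0).
Proof.
move=> [a ga].
have [a0|/existsNP] := pselect (forall n, a n = 0).
  left; apply: nbhs_dnbhs; near=> z.
  have : series (fun n => a n * (z - z0) ^+ n) @ \oo --> g z by near: z.
  rewrite (_ : series _ = fun=> 0); last first.
    by apply/funext => n; rewrite /series /= big1 // => i _; rewrite a0 mul0r.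
  by move=> /cvg_unique; apply; [exact: norm_hausdorff|exact: cvg_cst].
move=> [n0 /eqP an0]; right.
have exk : exists k, a k != 0 by exists n0.
set k := ex_minn exk.
have [ak kmin] : a k != 0 /\ forall n, a n != 0 -> (k <= n)%N.
  by rewrite /k; case: ex_minnP.
have alt n : (n < k)%N -> a n = 0.
  by move=> nk; apply/eqP; apply: contraLR nk => /kmin; rewrite leqNgt.
move: (ga) => /nbhs_normP[d /= d0 ga'].
(* Any radius inside the disc of convergence bounds the coefficients. *)
pose rho := d / 2.
have rho0 : 0 < rho by rewrite divr_gt0.
have : series (fun n => a n * rho ^+ n) @ \oo --> g (z0 + rho).
  have := ga' (z0 + rho).
  rewrite /ball_ /= opprD addNKr normrN gtr0_norm // [rho < d]ltr_pdivrMr // mulr2n mulrDr mulr1.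
  rewrite ltrDl => /(_ d0).
  by rewrite addrAC subrr add0r.
move=> /cvgP/cvg_series_cvg_0/cvgP/cvg_seq_bounded.
move=> /pinfty_ex_gt0[B B0 /= aB].
have {}aB n : `|a n| * rho ^+ n <= B.
  by have := aB n; rewrite /= normrM normrX (gtr0_norm rho0); exact.
pose c := `|a k| * rho ^+ k.
have c0 : 0 < c by rewrite mulr_gt0 ?normr_gt0 // exprn_gt0.
(* For |z - z0| = q rho with q <= 1/2 the tail is at most 2 B q^(k+1), hence at
   most half of the leading term c q^k as soon as q <= e. *)
pose e := c / (4 * B).
have e0 : 0 < e by rewrite divr_gt0 // mulr_gt0.
have ball_near r : 0 < r -> \forall z \near z0^', `|z - z0| < r.
  move=> r0; apply: nbhs_dnbhs; apply/nbhs_normP; exists r => //= y.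
  by rewrite /ball_ /= distrC.
near=> z.
have z12 : `|z - z0| < 2^-1 * rho.
  by near: z; apply: ball_near; rewrite mulr_gt0 // invr_gt0.
have ze : `|z - z0| < e * rho by near: z; apply: ball_near; rewrite mulr_gt0.
set w := z - z0.
have w0 : w != 0 by rewrite subr_eq0; near: z; exact: nbhs_dnbhs_neq.
pose q := `|w| / rho.
have q0 : 0 < q by rewrite divr_gt0 // normr_gt0.
have q12 : q <= 2^-1.
  by rewrite ler_pdivrMr // ltW.
have qe : q <= e.
  by rewrite ler_pdivrMr // ltW.
have gz : series (fun n => a n * (z - z0) ^+ n) @ \oo --> g z.
  by near: z; exact: nbhs_dnbhs.
have wE n : `|a n * w ^+ n| = `|a n| * rho ^+ n * q ^+ n.
  by rewrite normrM normrX -mulrA -exprMn [rho * q]mulrC /q divfK // gt_eqF.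
have tail M : `|\sum_(k.+1 <= n < k.+1 + M) a n * w ^+ n| <= (B * 2) * q ^+ k.+1.
  have : \sum_(k.+1 <= n < k.+1 + M) `|a n * w ^+ n| <=
         (B * 2) * (q ^+ k.+1 - q ^+ (k.+1 + M)).
    elim: M => [|M IH]; first by rewrite addn0 subrr mulr0 big_geq.
    rewrite addnS big_nat_recr ?leq_addr //=; move: (k.+1 + M)%N IH => n IH.
    apply: le_trans (lerD IH _) _.
      by rewrite wE; apply: ler_wpM2r (aB n); rewrite exprn_ge0 // ltW.
    rewrite -subr_ge0.
    have -> : B * 2 * (q ^+ k.+1 - q ^+ n.+1) - (B * 2 * (q ^+ k.+1 - q ^+ n) + B * q ^+ n) =
       B * q ^+ n * (2 * (2^-1 - q)) by rewrite [q ^+ n.+1]exprS; field.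
    by rewrite !mulr_ge0 ?subr_ge0 ?exprn_ge0 ?(ltW q0) ?(ltW B0).
  move=> h; apply: le_trans (ler_norm_sum _ _ _) (le_trans h _).
  rewrite ler_wpM2l //; first by rewrite mulr_ge0 // ltW.
  by rewrite gerBl exprn_ge0 // ltW.
have lb M : c * q ^+ k * 2^-1 <= `|series (fun n => a n * w ^+ n) (k.+1 + M)|.
  rewrite /series /= (@big_cat_nat _ _ _ k.+1) ?leq_addr //=.
  rewrite big_nat_recr //= big_nat_cond big1 ?add0r; last first.
    by move=> i; rewrite andbT => /andP[_ ik]; rewrite alt // mul0r.
  apply: le_trans (lerB_normD _ _).
  rewrite wE -/c.
  apply: le_trans (lerB (lexx _) (tail M)).
  rewrite -subr_ge0.
  have -> : c * q ^+ k - B * 2 * q ^+ k.+1 - c * q ^+ k / 2 =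
    2 * B * q ^+ k * (e - q) by rewrite exprS /e; field; rewrite gt_eqF.
  by rewrite !mulr_ge0 ?subr_ge0 ?exprn_ge0 ?(ltW q0) ?(ltW B0).
apply/negP => /eqP gz0; move: gz; rewrite gz0.
have c'0 : 0 < c * q ^+ k * 2^-1.
  by apply: mulr_gt0; [apply: mulr_gt0; rewrite ?exprn_gt0|rewrite invr_gt0].
move=> /cvgr0_norm_lt/(_ _ c'0)[M _ /(_ (k.+1 + M)%N)] /=.
rewrite leq_addl => /(_ isT) /(le_lt_trans (lb M)).
by rewrite ltxx.
Unshelve. all: by end_near. Qed.

(** Multiplying by a power of [z - z0] does not change the zeros off [z0]. *)
Lemma mero_at_dichotomy f z0 : mero_at f z0 ->
  (\forall z \near z0^', f z = 0) \/ (\forall z \near z0^', f z != 0).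
Proof.
move=> [m [g [/analytic_at_dichotomy + fg]]].
have dz : \forall z \near z0^', (z - z0) ^+ m != 0.
  near=> z; rewrite expf_neq0 // subr_eq0; near: z; exact: nbhs_dnbhs_neq.
case=> g0; [left|right]; near=> z.
  have /eqP : f z * (z - z0) ^+ m = 0.
    by rewrite (_ : _ * _ = g z); near: z.
  by rewrite mulf_eq0 => /orP[/eqP//|]; apply: contraTeq => _; near: z.
have : f z * (z - z0) ^+ m != 0.
  by rewrite (_ : _ * _ = g z); near: z.
by rewrite mulf_eq0 => /norP[].
Unshelve. all: by end_near. Qed.

(** Applied to vanishing and to nonvanishing, this makes the two alternatives of
[mero_at_dichotomy] open conditions on the point. *)
Lemma near_dnbhs_open (z : K) (P : K -> Prop) :
  (\forall y \near z^', P y) -> \forall x \near z, \forall y \near x^', P y.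
Proof.
rewrite /dnbhs /within /= => Pz.
have {Pz} : nbhs z (fun y => y != z -> P y) by [].
move/near_join; apply: filterS => x Px.
have [xz|xz] := eqVneq x z; first by move: Px; rewrite xz.
have yz : \forall y \near x, y != z.
  apply/nbhs_normP; exists `|x - z|; first by rewrite /= normr_gt0 subr_eq0.
  move=> y; rewrite /ball_ /= => xy; apply/eqP => yz.
  by move: xy; rewrite yz ltxx.
by apply: filterS2 Px yz => y Py yz _; exact: Py.
Qed.

End GermDichotomy.

(** * The identity theorem on the complex plane *)

Section IdentityTheorem.
Variable R : realType.
Let K : numFieldType := R[i].
Implicit Types (f g h : K -> K) (z w : K) (P : K -> Prop).

Lemma complex_gt0E (e : R[i]) : 0 < e -> exists2 r : R, 0 < r & e = r%:C.
Proof.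
by case: e => a b; rewrite ltcE /= => /andP[/eqP -> a0]; exists a.
Qed.

Lemma normc_real (x : R) : `|x%:C| = `|x|%:C.
Proof. by rewrite normc_def /= expr0n /= addr0 sqrtr_sqr. Qed.

(** Real segments in the plane are continuous.  The radius of a complex ball is a
positive element of [R[i]], that is, a positive real number. *)
Lemma near_segment z w (t : R) P : (\forall y \near (z + t%:C * w : K), P y) ->
  \forall s \near t, P (z + s%:C * w).
Proof.
move=> /nbhs_normP[e /= /complex_gt0E[r r0 ->]] Pb.
have [u u0 uE] : exists2 u : R, 0 <= u & `|w| = u%:C.
  have := normr_ge0 w; rewrite le_eqVlt => /orP[/eqP <-|/complex_gt0E[u u0 ->]].
    by exists 0.
  by exists u => //; exact: ltW.
have u1 : 0 < u + 1 by apply: ltr_wpDl.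
apply/nbhs_normP; exists (r / (u + 1)); first by rewrite /= divr_gt0.
move=> s /=; rewrite /ball_ /= ltr_pdivlMr // => ts.
apply: Pb; rewrite /ball_ /=.
have -> : z + t%:C * w - (z + s%:C * w) = (t - s)%:C * w by rewrite rmorphB /=; ring.
rewrite normrM uE normc_real -rmorphM /= ltcR.
by apply: le_lt_trans ts; rewrite ler_wpM2l // lerDl.
Qed.

(** Any two points are joined by a segment, and the parameters at which the
difference vanishes on a punctured neighbourhood form a clopen subset of the
real line; the segment starts on the half-line, where this subset is met. *)
Lemma mero_eq_of_real_half_line f g (c : R) :
  (forall z, mero_at (fun w => f w - g w) z) ->
  (forall x : R, c < x -> f x%:C = g x%:C) -> mero_eq f g.
Proof.
move=> fgm fg z.
pose h w := f w - g w.
pose A w := \forall y \near w^', h y = 0.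
pose B w := \forall y \near w^', h y != 0.
have AB w : A w \/ B w by exact: mero_at_dichotomy.
have nAB w : A w -> B w -> False.
  move=> Aw Bw.
  have : \forall y \near w^', False.
    near=> y.
    have : h y = 0 by near: y.
    by apply/eqP; near: y.
  by move=> /filter_ex[].
pose z1 : K := (c + 1)%:C.
have A1 : A z1.
  have [//|/nbhs_normP[e /= /complex_gt0E[r r0 ->]] /(_ (z1 + (r / 2)%:C))] := AB z1.
  rewrite /ball_ /= opprD addNKr normrN normc_real ltcR gtr0_norm ?divr_gt0 //.
  rewrite ltr_pdivrMr // mulr2n mulrDr mulr1 ltrDl => /(_ r0).
  have -> : z1 + (r / 2)%:C != z1.
    by rewrite -subr_eq0 addrAC subrr add0r (inj_eq (@complexI R) _ 0) gt_eqF // divr_gt0.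
  move=> /(_ isT).
  rewrite /h -rmorphD /= fg ?subrr ?eqxx //.
  by rewrite -addrA ltrDl addr_gt0 // divr_gt0.
pose p (t : R) := z1 + t%:C * (z - z1).
have opA : open [set t | A (p t)].
  rewrite openE => t /= At.
  exact: (near_segment (near_dnbhs_open At)).
have opB : open [set t | B (p t)].
  rewrite openE => t /= Bt.
  exact: (near_segment (near_dnbhs_open Bt)).
have cT : connected [set: R] by apply/connected_intervalP.
have AT : [set t | A (p t)] = setT.
  apply: cT; first by exists 0; rewrite /= /p mul0r addr0.
    by exists [set t | A (p t)] => //; rewrite classical_sets.setTI.
  exists [set t | A (p t)]; last by rewrite classical_sets.setTI.
  rewrite -openC (_ : ~` _ = [set t | B (p t)]) //.
  apply/seteqP; split => t /=; last by move=> Bt At; exact: nAB At Bt.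
  by have [//|] := AB (p t).
have : A (p 1) by move: (I : [set: R] 1); rewrite -AT.
rewrite /p mul1r addrC subrK /A => Az; near=> y.
by apply/eqP; rewrite -subr_eq0; apply/eqP; near: y.
Unshelve. all: by end_near. Qed.

End IdentityTheorem.

(** * Sums of nonnegative families *)

Section NonnegativeSums.
Variable R : realType.

Lemma ler_sum_fset (I : choiceType) (x : I -> R) (A B : {fset I}) :
  (forall i, 0 <= x i) -> (A `<=` B)%fset ->
  \sum_(i <- A) x i <= \sum_(i <- B) x i.
Proof.
move=> x0 AB; rewrite (big_fsetID _ (mem A) B) /= (_ : [fset y in B | y \in A]%fset = A).
  by rewrite lerDl sumr_ge0.
apply/fsetP => y; rewrite !inE /=.
by case yA : (y \in A); rewrite ?andbF // andbT; apply: (fsubsetP AB).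
Qed.

(** Finite partial sums of a nonnegative family increase along the inclusion, so
that the limit along finite subsets is their supremum. *)
Lemma usum_nonneg (I : choiceType) (x : I -> R) (l : R) :
  (forall i, 0 <= x i) ->
  (forall A : {fset I}, \sum_(i <- A) x i <= l) ->
  (forall e, 0 < e -> exists A : {fset I}, l - e < \sum_(i <- A) x i) ->
  usum (fun i => (x i)%:C) = l%:C.
Proof.
move=> x0 xl lx.
have FF : ProperFilter (@summability.totally I) := summability.totally_filter.
apply: cvg_lim; first exact: norm_hausdorff.
apply/cvgrPdist_lt => _ /complex_gt0E[e e0 ->].
have [A lA] := lx _ e0.
exists A => //= B /= AB.
rewrite /summability.partial_sum -(big_seq_fsetE _ B xpredT (fun i => (x i)%:C)) /=.
rewrite -rmorph_sum -rmorphB /= normc_real ltcR ger0_norm ?subr_ge0 //.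
rewrite ltrBlDr -ltrBlDl; apply: (lt_le_trans lA).
exact: ler_sum_fset.
Qed.

Definition ffun_nat n M (f : {ffun 'I_n -> 'I_M}) : {ffun 'I_n -> nat} :=
  [ffun i => f i : nat].

(** Boxes are cofinal among the finite sets of tuples and are themselves products,
so truncation to a box commutes with products of series ([boxsum_prod]) while
still computing unconditional sums ([usum_boxsum]). *)
Definition boxsum n M (x : {ffun 'I_n -> nat} -> R) : R :=
  \sum_(f : {ffun 'I_n -> 'I_M}) x (ffun_nat f).

Lemma ffun_nat_inj n M : injective (@ffun_nat n M).
Proof.
move=> f g fg; apply/ffunP => i; apply: val_inj.
by move/ffunP : fg => /(_ i); rewrite !ffunE.
Qed.

Lemma boxsum_fset n M (x : {ffun 'I_n -> nat} -> R) :
  boxsum M x = \sum_(f <- [fset ffun_nat f | f in {: {ffun 'I_n -> 'I_M}}]%fset) x f.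
Proof.
rewrite big_imfset /=; last by move=> f g _ _; exact: ffun_nat_inj.
by rewrite /boxsum -big_enum.
Qed.

Lemma fset_sub_box n (A : {fset {ffun 'I_n -> nat}}) :
  exists M0, forall M, (M0 <= M)%N ->
    (A `<=` [fset ffun_nat f | f in {: {ffun 'I_n -> 'I_M}}])%fset.
Proof.
exists (\max_(f <- A) \max_i (f i).+1) => M AM.
apply/fsubsetP => f fA.
have fM i : (f i < M)%N.
  apply: leq_trans AM; apply: leq_trans (leq_bigmax_seq _ fA isT).
  exact: (leq_bigmax_cond (F := fun i => (f i).+1)).
apply/imfsetP; exists [ffun i => Ordinal (fM i)] => //.
by apply/ffunP => i; rewrite !ffunE.
Qed.

Lemma le_boxsum n (x y : {ffun 'I_n -> nat} -> R) M :
  (forall m, x m <= y m) -> boxsum M x <= boxsum M y.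
Proof. by move=> xy; apply: ler_sum => f _. Qed.

Lemma boxsum_ge0 n (x : {ffun 'I_n -> nat} -> R) M :
  (forall m, 0 <= x m) -> 0 <= boxsum M x.
Proof. by move=> x0; apply: sumr_ge0. Qed.

Lemma nondecreasing_boxsum n (x : {ffun 'I_n -> nat} -> R) :
  (forall m, 0 <= x m) -> nondecreasing_seq (fun M => boxsum M x).
Proof.
move=> x0 M M' MM'; rewrite !boxsum_fset; apply: ler_sum_fset => //.
apply/fsubsetP => f /imfsetP[g _ ->].
apply/imfsetP; exists [ffun i => widen_ord MM' (g i)] => //.
by apply/ffunP => i; rewrite !ffunE.
Qed.

(** Every finite set of tuples lies in a box. *)
Lemma usum_boxsum n (x : {ffun 'I_n -> nat} -> R) (l : R) :
  (forall m, 0 <= x m) -> (fun M => boxsum M x) @ \oo --> l ->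
  usum (fun m => (x m)%:C) = l%:C.
Proof.
move=> x0 xl.
have ub M : boxsum M x <= l.
  have := nondecreasing_cvgn_le (nondecreasing_boxsum x0) (cvgP _ xl) M.
  by rewrite (cvg_lim _ xl) //.
apply: usum_nonneg => //.
- move=> A; have [M AM] := fset_sub_box A.
  by apply: le_trans (ub M); rewrite boxsum_fset; apply: ler_sum_fset (AM _ _).
- move=> e e0; move/cvgrPdist_lt : xl => /(_ _ e0)[M _ /(_ M)] /=.
  rewrite leqnn => /(_ isT); rewrite ger0_norm ?subr_ge0 // => h.
  exists [fset ffun_nat f | f in {: {ffun 'I_n -> 'I_M}}]%fset.
  by rewrite -boxsum_fset ltrBlDr -ltrBlDl.
Qed.

Lemma usum_nat (x : nat -> R) (l : R) : (forall m, 0 <= x m) ->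
  series x @ \oo --> l -> usum (fun m => (x m)%:C) = l%:C.
Proof.
move=> x0 xl.
have nd : nondecreasing_seq (series x).
  by apply/nondecreasing_seqP => M; rewrite /series /= big_nat_recr //= lerDl.
have ub M : series x M <= l.
  by have := nondecreasing_cvgn_le nd (cvgP _ xl) M; rewrite (cvg_lim _ xl) //.
have sE M : series x M = \sum_(i <- [fset val i | i in {: 'I_M}]%fset) x i.
  rewrite big_imfset /=; last by move=> f g _ _; exact: val_inj.
  by rewrite /series /= big_mkord -big_enum.
apply: usum_nonneg => //.
- move=> A; apply: le_trans (ub (\max_(i <- A) i.+1)); rewrite sE.
  apply: ler_sum_fset => //; apply/fsubsetP => i iA; apply/imfsetP.
  have iM : (i < \max_(i <- A) i.+1)%N by exact: leq_bigmax_seq iA isT.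
  by exists (Ordinal iM).
- move=> e e0; move/cvgrPdist_lt : xl => /(_ _ e0)[M _ /(_ M)] /=.
  rewrite leqnn => /(_ isT); rewrite ger0_norm ?subr_ge0 // => h.
  by exists [fset val i | i in {: 'I_M}]%fset; rewrite -sE ltrBlDr -ltrBlDl.
Qed.

Lemma boxsum_prod n M (a : 'I_n -> nat -> R) :
  boxsum M (fun m => \prod_i a i (m i)) = \prod_i \sum_(0 <= j < M) a i j.
Proof.
under [RHS]eq_bigr do rewrite big_mkord.
rewrite bigA_distr_bigA; apply: eq_bigr => f _.
by apply: eq_bigr => i _; rewrite ffunE.
Qed.

Lemma eq_boxsum n M (x y : {ffun 'I_n -> nat} -> R) : x =1 y -> boxsum M x = boxsum M y.
Proof. by move=> xy; apply: eq_bigr. Qed.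

Lemma boxsumD n M (x y : {ffun 'I_n -> nat} -> R) :
  boxsum M (fun m => x m + y m) = boxsum M x + boxsum M y.
Proof. exact: big_split. Qed.

End NonnegativeSums.

(** * Euler's integral for s >= 1 *)

Section GammaIntegral.
Variable R : realType.
Notation mu := (@lebesgue_measure R).
Notation D := (`]0%R, +oo[%classic : set R).

Lemma cvg_EFin_seq (u : nat -> R) (l : R) :
  u n @[n --> \oo] --> l -> (u n)%:E @[n --> \oo] --> l%:E.
Proof. by move=> ul; apply: cvg_EFin => //; exact: filterE. Qed.

Lemma cvg_integral_nondecreasing (A : set R) (g : nat -> R -> R) (f : R -> R) :
  measurable A -> (forall n, measurable_fun A (g n)) ->
  (forall n x, A x -> 0 <= g n x) ->
  (forall x, A x -> nondecreasing_seq (g^~ x)) ->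
  (forall x, A x -> g n x @[n --> \oo] --> f x) ->
  (\int[mu]_(x in A) (g n x)%:E)%E @[n --> \oo] --> (\int[mu]_(x in A) (f x)%:E)%E.
Proof.
move=> mA mg g0 ndg gf.
have -> : (\int[mu]_(x in A) (f x)%:E = \int[mu]_(x in A) limn (fun n => (g n x)%:E))%E.
  apply: eq_integral => x /set_mem Ax; apply/esym/cvg_lim => //.
  by apply: cvg_EFin_seq; exact: gf.
apply: cvg_monotone_convergence => //.
by move=> n; apply/measurable_EFinP; exact: mg.
Qed.

(** Extended-real values let Euler's integral enter monotone convergence before it
is known to be finite. *)
Definition eGamma (s : R) : \bar R := (\int[mu]_(t in D) (t `^ (s - 1) * expR (- t))%:E)%E.

Lemma measurable_powR_exp (s a : R) (A : set R) :
  measurable_fun A (fun t => t `^ s * expR (- (a * t))).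
Proof.
apply: measurable_funTS; apply: measurable_funM; first exact: measurable_powR.
apply: measurableT_comp; first exact: measurable_expR.
by apply: measurableT_comp => //; apply: measurable_funM.
Qed.

Lemma powR_at_right0 (a : R) : 0 <= a -> t `^ a @[t --> 0^'+] --> 0 `^ a.
Proof.
rewrite le_eqVlt => /orP[/eqP <-|a0].
  rewrite powRr0; under eq_fun do rewrite powRr0.
  exact: cvg_cst.
by rewrite powR0 ?gt_eqF //; exact: powR_cvg0.
Qed.

Lemma continuous_powR_pos (a x : R) : 0 < x -> {for x, continuous (fun t => t `^ a)}.
Proof.
move=> x0; apply/differentiable_continuous/derivable1_diffP.
by apply: derivable_powR; rewrite in_itv /= x0.
Qed.

Lemma continuous_expRNM (a : R) : continuous (fun t : R => expR (- (a * t))).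
Proof.
move=> t; apply: continuous_comp; last exact: continuous_expR.
by apply: continuousN; apply: continuousM => //; exact: cst_continuous.
Qed.

Lemma continuous_expRN : continuous (fun t : R => expR (- t)).
Proof.
rewrite (_ : (fun t => _) = fun t => expR (- (1 * t))); first exact: continuous_expRNM.
by apply/funext => t; rewrite mul1r.
Qed.

Lemma measurable_powR_expN (s : R) (A : set R) :
  measurable_fun A (fun t => t `^ s * expR (- t)).
Proof.
apply: measurable_funTS; apply: measurable_funM; first exact: measurable_powR.
by apply: measurableT_comp; [exact: measurable_expR|exact: oppr_measurable].
Qed.

Lemma within_continuous_powR_exp (s a : R) : 0 <= s ->
  {within `[0, +oo[, continuous (fun t => t `^ s * expR (- (a * t)))}.
Proof.
move=> s0; apply/continuous_within_itvcyP; split.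
  move=> x; rewrite in_itv /= andbT => x0.
  by apply: cvgM; [exact: continuous_powR_pos|exact: continuous_expRNM].
apply: cvgM; first exact: powR_at_right0.
by apply: cvg_at_right_filter; exact: continuous_expRNM.
Qed.

Lemma integral_0y (f : R -> R) : measurable_fun setT f ->
  (\int[mu]_(t in D) (f t)%:E = \int[mu]_(t in `[0%R, +oo[) (f t)%:E)%E.
Proof.
move=> mf; apply: integral_itv_obnd_cbnd.
by apply/measurable_EFinP; exact: measurable_funTS.
Qed.

(** Substitution u = a t.  The bound on [s] makes the integrand continuous at 0. *)
Lemma integral_powR_exp (s a : R) : 1 <= s -> 0 < a ->
  (\int[mu]_(t in D) (t `^ (s - 1) * expR (- (a * t)))%:E = (a `^ (- s))%:E * eGamma s)%E.
Proof.
move=> s1 a0.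
have GE : eGamma s = (\int[mu]_(t in `[0%R, +oo[) (t `^ (s - 1) * expR (- (1 * t)))%:E)%E.
  rewrite /eGamma integral_0y.
    by under eq_integral do rewrite -[X in expR (- X)]mul1r.
  by under eq_fun do rewrite -[X in expR (- X)]mul1r; exact: measurable_powR_exp.
pose F (t : R) := a * t.
have dF : derive1 F = cst a.
  by apply/funext => t; rewrite /F derive1Ml // derive1_id mulr1.
have := @increasing_ge0_integration_by_substitutiony R F
  (fun t => t `^ (s - 1) * expR (- (1 * t))) 0.
have F0 : F 0 = 0 by rewrite /F mulr0.
rewrite dF F0 -GE => ->; first last.
- move=> x _; by rewrite mulr_ge0 ?powR_ge0 ?expR_ge0.
- by apply: within_continuous_powR_exp; rewrite subr_ge0.
- exact: gt0_cvgMry.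
- split; first by move=> x _; rewrite /F; apply: derivableM.
  by apply: cvg_at_right_filter; apply: cvgM; [exact: cvg_cst|exact: cvg_id].
- exact: is_cvg_cst.
- exact: is_cvg_cst.
- by move=> x _; exact: cst_continuous.
- by move=> x y _ _ xy; rewrite /F ltr_pM2l.
rewrite integral_0y; last exact: measurable_powR_exp.
rewrite -ge0_integralZl_EFin ?powR_ge0 //; last 2 first.
- by move=> x _; rewrite lee_fin !mulr_ge0 ?powR_ge0 ?expR_ge0 // ltW.
- apply/measurable_EFinP; apply: measurable_funM => //=.
  apply: (@measurableT_comp _ _ _ _ _ _ (fun t : R => t `^ (s - 1) * expR (- (1 * t))) _ F).
    exact: measurable_powR_exp.
  by apply: measurable_funM.
apply: eq_integral => x; rewrite inE /= in_itv /= andbT => x0.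
rewrite -EFinM mulrfctE /=; congr EFin; rewrite /F mul1r powRM // ?(ltW a0) //.
have aE : a `^ (- s) * a `^ (s - 1) * a = 1.
  rewrite -powRD; last by rewrite (gt_eqF a0) implybT.
  by rewrite addrA addNr add0r powR_inv1 ?mulVf ?(gt_eqF a0) // ltW.
by rewrite -[LHS]mul1r -{1}aE; ring.
Qed.

(** One term of the exponential series already beats the power. *)
Lemma powR_exp_cvg0 (s : R) : n.+1%:R `^ s * expR (- n.+1%:R) @[n --> \oo] --> (0 : R).
Proof.
have [k sk] : exists k : nat, s <= k%:R.
  by exists (Num.bound `|s|); exact: le_trans (ler_norm s) (ltW (archi_boundP (normr_ge0 s))).
apply: (@squeeze_cvgr _ _ _ _ (fun=> 0) (fun n => k.+1`!%:R * n.+1%:R^-1)).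
- near=> n; rewrite mulr_ge0 ?powR_ge0 ?expR_ge0 //=.
  have le1 : n.+1%:R `^ s <= n.+1%:R ^+ k :> R.
    by rewrite -powR_mulrn // ler_powR // ler1n.
  apply: le_trans (ler_wpM2r (expR_ge0 _) le1) _.
  rewrite expRN ler_pdivrMr ?expR_gt0 // mulrAC ler_pdivlMr ?ltr0n //.
  rewrite -exprSr mulrC -ler_pdivrMr ?ltr0n ?fact_gt0 //.
  by have := expR_ge1Dxn k (ler0n R n.+1); apply: le_trans; rewrite lerDr.
- exact: cvg_cst.
- rewrite -[X in _ --> X](mulr0 (k.+1`!%:R)); apply: cvgMr.
  exact: cvg_harmonic.
Unshelve. all: by end_near. Qed.

Lemma is_derive_opp_expRN (x : R) : is_derive x 1 (fun t : R => - expR (- t)) (expR (- x)).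
Proof.
have dN : is_derive x 1 (fun t : R => - t) (-1) by exact: is_deriveN.
apply: (is_derive_eq (is_deriveN (is_derive1_comp (is_derive_expR (- x)) dN))).
by rewrite mulrN1 opprK.
Qed.

(** Integration by parts on [0, n]; the boundary term at n vanishes in the limit by
[powR_exp_cvg0]. *)
Lemma eGammaS (s : R) : 1 <= s -> (eGamma (s + 1) = s%:E * eGamma s)%E.
Proof.
move=> s1.
have s0 : 0 < s by exact: lt_le_trans s1.
have cvg_to (p : R) : 0 <= p ->
    (\int[mu]_(t in `[0%R, n.+1%:R]) (t `^ p * expR (- t))%:E)%E @[n --> \oo] -->
    (\int[mu]_(t in D) (t `^ p * expR (- t))%:E)%E.
  move=> p0.
  have mf A : measurable_fun A (fun t : R => t `^ p * expR (- t)).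
    exact: measurable_powR_expN.
  rewrite integral_0y // itv_bndy_bigcup_BRight.
  pose u (n : nat) := (\int[mu]_(t in `[0%R, n%:R]) (t `^ p * expR (- t))%:E)%E.
  rewrite (cvg_shiftS u).
  rewrite (_ : u = (fun n =>
    (\int[mu]_(t in `[0%R, (0 + n%:R)%R]) (t `^ p * expR (- t))%:E)%E)); last first.
    by apply/funext => n; rewrite /u add0r.
  apply: ge0_nondecreasing_set_cvg_integral.
  - move=> n m nm; apply/subsetPset => x /=; rewrite !in_itv /= => /andP[-> xn].
    by apply: le_trans xn _; rewrite lerD2l ler_nat.
  - by move=> n; exact: measurable_itv.
  - by move=> n; apply/measurable_EFinP; exact: mf.
  - by move=> n x _; rewrite lee_fin mulr_ge0 ?powR_ge0 ?expR_ge0.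
have ibp n : (\int[mu]_(t in `[0%R, n.+1%:R]) (t `^ s * expR (- t))%:E +
    (n.+1%:R `^ s * expR (- n.+1%:R))%:E =
    s%:E * \int[mu]_(t in `[0%R, n.+1%:R]) (t `^ (s - 1) * expR (- t))%:E)%E.
  pose G (t : R) := - expR (- t).
  have cE t : {for t, continuous (fun t : R => expR (- t))}.
    exact: continuous_expRN.
  rewrite (@integration_by_parts R (fun t => t `^ s) G
    (fun t => s * t `^ (s - 1)) (fun t => expR (- t)) 0 n.+1%:R) ?ltr0n //; first last.
  - by move=> x _; rewrite derive1E; have [_ ->] := is_derive_opp_expRN x.
  - split.
    + by move=> x _; have [] := is_derive_opp_expRN x.
    + by apply/cvg_at_right_filter; apply: cvgN; exact: cE.
    + by apply/cvg_at_left_filter; apply: cvgN; exact: cE.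
  - by apply: continuous_subspaceT => x; exact: cE.
  - by move=> x; rewrite in_itv /= => /andP[x0 _]; rewrite powR_derive1 // in_itv /= x0.
  - split.
    + by move=> x; rewrite in_itv /= => /andP[x0 _]; apply: derivable_powR; rewrite in_itv /= x0.
    + by apply: powR_at_right0; exact: ltW.
    + by apply/cvg_at_left_filter; apply: continuous_powR_pos; rewrite ltr0n.
  - have sub0 : (`[0, n.+1%:R]%classic : set R) `<=` `[0, +oo[%classic.
      by move=> x /=; rewrite !in_itv /= => /andP[-> _].
    apply: (continuous_subspaceW sub0).
    apply/continuous_within_itvcyP; split.
      move=> x; rewrite in_itv /= andbT => x0.
      by apply: cvgM; [exact: cst_continuous|exact: continuous_powR_pos].
    by apply: cvgM; [exact: cvg_cst|apply: powR_at_right0; rewrite subr_ge0].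
  have -> : (\int[mu]_(t in `[0%R, n.+1%:R]) (s * t `^ (s - 1) * G t)%:E =
      \int[mu]_(t in `[0%R, n.+1%:R]) - (s%:E * (t `^ (s - 1) * expR (- t))%:E))%E.
    by apply: eq_integral => t _; rewrite -EFinM -EFinN /G; congr EFin; ring.
  rewrite integral_ge0N; last first.
    by move=> x _; rewrite lee_fin !mulr_ge0 ?powR_ge0 ?expR_ge0 // ltW.
  rewrite oppeK powR0 ?gt_eqF // mul0r subr0 /G mulrN addeC addeA -EFinD subrr add0e.
  rewrite ge0_integralZl_EFin ?(ltW s0) //.
  - by move=> x _; rewrite lee_fin mulr_ge0 ?powR_ge0 ?expR_ge0.
  - apply/measurable_EFinP.
    exact: measurable_powR_expN.
rewrite -[LHS]adde0 /eGamma addrK; apply/esym.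
pose u n := (s%:E * \int[mu]_(t in `[0%R, n.+1%:R]) (t `^ (s - 1) * expR (- t))%:E)%E.
have h1 : u n @[n --> \oo] --> (s%:E * \int[mu]_(t in D) (t `^ (s - 1) * expR (- t))%:E)%E.
  by apply: cvgeZl => //; apply: cvg_to; rewrite subr_ge0.
suff h2 : u n @[n --> \oo] --> (\int[mu]_(t in D) (t `^ s * expR (- t))%:E + 0)%E.
  exact: (cvg_unique (@ereal_hausdorff R) h1 h2).
rewrite /u; under eq_cvg do rewrite -ibp.
apply: cvgeD; first by rewrite fin_num_adde_defl.
  by apply: cvg_to; exact: ltW.
by apply: cvg_EFin_seq; exact: powR_exp_cvg0.
Qed.

Lemma eGamma1 : eGamma (1 : R) = 1%E.
Proof.
rewrite /eGamma subrr integral_0y; last first.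
  exact: measurable_powR_expN.
under eq_integral do rewrite powRr0 mul1r.
have cE t : {for t, continuous (fun t : R => expR (- t))}.
  exact: continuous_expRN.
rewrite (@ge0_continuous_FTC2y R _ (fun t => - expR (- t)) 0 0).
- by rewrite oppr0 expR0 EFinN oppeK add0e.
- by move=> x _; exact: expR_ge0.
- by apply: continuous_subspaceT => x; exact: cE.
- by rewrite -oppr0; apply: cvgN; exact: cvgr_expR.
- by move=> x _; have [] := is_derive_opp_expRN x.
- by apply/cvg_at_right_filter; apply: cvgN; exact: cE.
- by move=> x _; rewrite derive1E; have [_ ->] := is_derive_opp_expRN x.
Qed.

Lemma eGamma_nat k : eGamma (k.+1%:R : R) = (k`!%:R)%:E.
Proof.
elim: k => [|k IH]; first by rewrite eGamma1.
by rewrite -[in LHS]natr1 eGammaS ?ler1n // IH -EFinM -natrM factS.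
Qed.

Lemma powR_exp_ge0 (s a t : R) : 0 <= t `^ s * expR a.
Proof. by rewrite mulr_ge0 ?powR_ge0 ?expR_ge0. Qed.

(** The integrand is at least exp (- 2) on [1, 2]. *)
Lemma eGamma_gt0 (s : R) : 1 <= s -> (0 < eGamma s)%E.
Proof.
move=> s1.
have le1 : ((expR (- 2))%:E <= eGamma s)%E.
  have sub12 : (`[1, 2]%classic : set R) `<=` D.
    by move=> x /=; rewrite !in_itv /= andbT => /andP[x1 _]; exact: lt_le_trans x1.
  apply: (@le_trans _ _ (\int[mu]_(t in `[1%R, 2%R]) (t `^ (s - 1) * expR (- t))%:E)%E); last first.
    apply: ge0_subset_integral => //.
      by apply/measurable_EFinP; exact: measurable_powR_expN.
    by move=> x _; rewrite lee_fin powR_exp_ge0.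
  have -> : (expR (- 2))%:E = (\int[mu]_(t in `[1%R, 2%R]) (cst (expR (- 2))%:E) t)%E.
    rewrite integral_cst //= lebesgue_measure_itv /= lte_fin ltr1n.
    by rewrite -EFinD (_ : 2 - 1 = 1 :> R) ?mule1 //; ring.
  apply: ge0_le_integral => //.
  - by move=> x _; rewrite lee_fin expR_ge0.
  - by apply/measurable_EFinP; exact: measurable_powR_expN.
  move=> x /=; rewrite in_itv /= => /andP[x1 x2].
  rewrite lee_fin -[leLHS]mul1r ler_pM ?expR_ge0 //.
    by rewrite -[leLHS](powRr0 x) ler_powR // subr_ge0.
  by rewrite ler_expR lerN2.
by apply: lt_le_trans le1; rewrite lte_fin expR_gt0.
Qed.

(** Comparison with the factorials: t^(s-1) <= 1 + t^k as soon as k >= s - 1. *)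
Lemma eGamma_lty (s : R) : 1 <= s -> (eGamma s < +oo)%E.
Proof.
move=> s1.
pose k := Num.bound `|s - 1|.
have sk : s - 1 <= k%:R.
  exact: le_trans (ler_norm _) (ltW (archi_boundP (normr_ge0 _))).
have : (eGamma s <= eGamma (1 : R) + eGamma (k.+1%:R : R))%E.
  rewrite /eGamma -ge0_integralD //; last first.
  - by apply/measurable_EFinP; exact: measurable_powR_expN.
  - by move=> x _; rewrite lee_fin powR_exp_ge0.
  - by apply/measurable_EFinP; exact: measurable_powR_expN.
  - by move=> x _; rewrite lee_fin powR_exp_ge0.
  apply: ge0_le_integral => //.
  - by move=> x _; rewrite lee_fin powR_exp_ge0.
  - by apply/measurable_EFinP; exact: measurable_powR_expN.
  - by apply: emeasurable_funD; apply/measurable_EFinP; exact: measurable_powR_expN.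
  move=> x /=; rewrite in_itv /= andbT => x0.
  rewrite -EFinD lee_fin -mulrDl ler_wpM2r ?expR_ge0 // subrr powRr0.
  rewrite -natr1 addrK.
  have [x1|x1] := leP x 1.
    apply: ler_wpDr; first exact: powR_ge0.
    by rewrite -[leRHS](powRr0 x) ger_powR ?x0 ?subr_ge0.
  by apply: ler_wpDl => //; apply: ler_powR => //; exact: ltW.
by move=> /le_lt_trans; apply; rewrite eGamma1 eGamma_nat -EFinD ltry.
Qed.

End GammaIntegral.

(** * Polylogarithms at exp (- t) and tails of u ^ r / (exp u - 1) *)

Section Polylog.
Variable R : realType.
Notation mu := (@lebesgue_measure R).
Notation D := (`]0%R, +oo[%classic : set R).

Lemma cvg_sumr (I : Type) (s : seq I) (P : pred I) (u : I -> nat -> R) (l : I -> R) :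
  (forall i, P i -> u i n @[n --> \oo] --> l i) ->
  (\sum_(i <- s | P i) u i n) @[n --> \oo] --> \sum_(i <- s | P i) l i.
Proof. by apply: cvg_big; exact: add_continuous. Qed.

Lemma cvg_prodr (I : Type) (s : seq I) (P : pred I) (u : I -> nat -> R) (l : I -> R) :
  (forall i, P i -> u i n @[n --> \oo] --> l i) ->
  (\prod_(i <- s | P i) u i n) @[n --> \oo] --> \prod_(i <- s | P i) l i.
Proof. by apply: cvg_big; exact: mul_continuous. Qed.

Definition Literm (k : nat) (t : R) (n : nat) : R :=
  expR (- (n.+1%:R * t)) / n.+1%:R ^+ k.

(** The polylogarithm Li_k at exp (- t), for [0 < t]. *)
Definition Liexp (k : nat) (t : R) : R := limn (series (Literm k t)).

Lemma Literm_ge0 k t n : 0 <= Literm k t n.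
Proof. by rewrite divr_ge0 ?expR_ge0 // exprn_ge0. Qed.

Lemma expR_sub1_gt0 (t : R) : 0 < t -> 0 < expR t - 1.
Proof. by move=> t0; rewrite subr_gt0 expR_gt1. Qed.

Lemma cvg_Literm0 t : 0 < t -> series (Literm 0 t) @ \oo --> (expR t - 1)^-1.
Proof.
move=> t0.
have -> : Literm 0 t = geometric (expR (- t)) (expR (- t)).
  apply/funext => n; rewrite /Literm expr0 divr1 /= -exprS -expRM_natl.
  by rewrite mulrN.
have -> : (expR t - 1)^-1 = expR (- t) / (1 - expR (- t)).
  rewrite expRN; field.
  by rewrite (gt_eqF (expR_gt0 t)) (gt_eqF (expR_sub1_gt0 t0)).
apply: cvg_geometric_series.
by rewrite ger0_norm ?expR_ge0 // expR_lt1 oppr_lt0.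
Qed.

Lemma nondecreasing_Literm k t : nondecreasing_seq (series (Literm k t)).
Proof.
by apply/nondecreasing_seqP => n; rewrite /series /= big_nat_recr //= lerDl Literm_ge0.
Qed.

(** Termwise comparison with the geometric series, which is the case k = 0. *)
Lemma cvg_Liexp k t : 0 < t -> series (Literm k t) @ \oo --> Liexp k t.
Proof.
move=> t0; apply: nondecreasing_is_cvgn; first exact: nondecreasing_Literm.
exists (expR t - 1)^-1 => _ [n _ <-].
have le0 : series (Literm 0 t) n <= (expR t - 1)^-1.
  have := nondecreasing_cvgn_le (nondecreasing_Literm 0 t) (cvgP _ (cvg_Literm0 t0)) n.
  by rewrite (cvg_lim _ (cvg_Literm0 t0)).
apply: le_trans le0; apply: ler_sum => i _.
rewrite /Literm expr0 divr1 ler_pdivrMr ?exprn_gt0 ?ltr0n //.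
by rewrite ler_peMr ?expR_ge0 // exprn_ege1 // ler1n.
Qed.

Lemma Liexp0 t : 0 < t -> Liexp 0 t = (expR t - 1)^-1.
Proof. by move=> t0; apply: cvg_lim => //; exact: cvg_Literm0. Qed.

Lemma Liexp_ge0 k t : 0 < t -> 0 <= Liexp k t.
Proof.
move=> t0; have cL := cvgP _ (@cvg_Liexp k t t0).
have := nondecreasing_cvgn_le (nondecreasing_Literm k t) cL 0%N.
by rewrite /series /= big_geq.
Qed.

Lemma measurable_Liseries k n (A : set R) : measurable_fun A (fun t => series (Literm k t) n).
Proof.
rewrite /series /=; apply: measurable_sum => i; apply: measurable_funM => //.
apply: measurable_funTS; apply: measurableT_comp; first exact: measurable_expR.
by apply: measurableT_comp; [exact: oppr_measurable|apply: measurable_funM].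
Qed.

Lemma measurable_Liexp k : measurable_fun D (Liexp k).
Proof.
apply: (@measurable_fun_cvg _ _ _ _ (fun n t => series (Literm k t) n)).
  by move=> n; exact: measurable_Liseries.
by move=> t /=; rewrite in_itv /= andbT => t0; exact: cvg_Liexp.
Qed.

Lemma integral_expn_exp k (a : R) : 0 < a ->
  (\int[mu]_(u in D) (u ^+ k * expR (- (a * u)))%:E = (k`!%:R / a ^+ k.+1)%:E)%E.
Proof.
move=> a0.
have -> : (\int[mu]_(u in D) (u ^+ k * expR (- (a * u)))%:E =
           \int[mu]_(u in D) (u `^ (k.+1%:R - 1) * expR (- (a * u)))%:E)%E.
  apply: eq_integral => u; rewrite inE /= in_itv /= andbT => u0.
  by rewrite -natr1 addrK powR_mulrn // ltW.
rewrite integral_powR_exp // ?ler1n // eGamma_nat -EFinM powR_invn ?(ltW a0) //.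
by rewrite mulrC.
Qed.

Lemma measurable_expn_exp (r : nat) (b : R) (A : set R) :
  measurable_fun A (fun u => u ^+ r * expR (- (b * u))).
Proof.
apply: measurable_funTS; apply: measurable_funM; first exact: exprn_measurable.
apply: measurableT_comp; first exact: measurable_expR.
by apply: measurableT_comp; [exact: oppr_measurable|apply: measurable_funM].
Qed.

Lemma expn_exp_ge0 (r : nat) (b x : R) : 0 <= x -> 0 <= x ^+ r * expR b.
Proof. by move=> x0; rewrite mulr_ge0 ?expR_ge0 // exprn_ge0. Qed.

(** Translating by [t] turns the tail into an integral over the half-line; the
binomial expansion of (u + t)^r then leaves integrals of [integral_expn_exp]. *)
Lemma integral_tail_expn_exp (r : nat) (a t : R) : 0 < a -> 0 <= t ->
  (\int[mu]_(u in `[t, +oo[) (u ^+ r * expR (- (a * u)))%:E =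
   (\sum_(i < r.+1) ('C(r, i) * (r - i)`!)%:R * t ^+ i *
      (expR (- (a * t)) / a ^+ (r - i).+1))%:E)%E.
Proof.
move=> a0 t0.
pose F (u : R) := u + t.
have dF : derive1 F = cst 1.
  apply/funext => u; rewrite /F derive1E.
  by have [_ ->] := is_deriveD (is_derive_id u (1 : R)) (is_derive_cst t u 1); rewrite addr0.
have F0 : F 0 = t by rewrite /F add0r.
have := @increasing_ge0_integration_by_substitutiony R F
  (fun u => u ^+ r * expR (- (a * u))) 0.
rewrite dF F0 => ->; first last.
- by move=> x; rewrite in_itv /= andbT => tx; apply: expn_exp_ge0; exact: le_trans (ltW tx).
- apply: continuous_subspaceT => x; apply: cvgM; first exact: exprn_continuous.
  exact: continuous_expRNM.
- exact: cvg_addrr.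
- split; first by move=> x _; rewrite /F; apply: derivableD.
  by apply: cvg_at_right_filter; apply: cvgD; [exact: cvg_id|exact: cvg_cst].
- exact: is_cvg_cst.
- exact: is_cvg_cst.
- by move=> x _; exact: cst_continuous.
- by move=> x y _ _ xy; rewrite /F ltrD2r.
pose c (i : 'I_r.+1) : R := 'C(r, i)%:R * t ^+ i * expR (- (a * t)).
have c0 i : 0 <= c i by rewrite !mulr_ge0 ?expR_ge0 // exprn_ge0.
have FE x : (((fun u : R => u ^+ r * expR (- (a * u))) \o F) * cst 1) x =
    \sum_i c i * (x ^+ (r - i) * expR (- (a * x))).
  rewrite mulrfctE /= mulr1 /F exprDn mulr_suml; apply: eq_bigr => i _.
  by rewrite mulrDr opprD expRD /c -mulr_natl; ring.
under eq_integral do rewrite FE -sumEFin.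
rewrite -(integral_itv_obnd_cbnd (r := 0)); last first.
  apply: emeasurable_sum => i; apply/measurable_EFinP; apply: measurable_funM => //.
  exact: measurable_expn_exp.
rewrite ge0_integral_sum //; last 2 first.
- move=> i; apply/measurable_EFinP; apply: measurable_funM => //.
  exact: measurable_expn_exp.
- move=> i x /=; rewrite in_itv /= andbT => x0; rewrite lee_fin mulr_ge0 //.
  by apply: expn_exp_ge0; exact: ltW.
rewrite -sumEFin; apply: eq_bigr => i _.
under eq_integral do rewrite EFinM.
rewrite ge0_integralZl_EFin //; last 2 first.
- move=> x /=; rewrite in_itv /= andbT => x0; rewrite lee_fin.
  by apply: expn_exp_ge0; exact: ltW.
- by apply/measurable_EFinP; exact: measurable_expn_exp.
rewrite integral_expn_exp // -EFinM; congr EFin.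
by rewrite /c natrM; ring.
Qed.

(** The integral of u^r / (exp u - 1) over [t, oo[ in closed form, see
[integral_MTtail]. *)
Definition MTtail (r : nat) (t : R) : R :=
  \sum_(i < r.+1) ('C(r, i) * (r - i)`!)%:R * t ^+ i * Liexp (r - i).+1 t.

(** 1 / (exp u - 1) is the increasing limit of the sums of exp (- m u) over
0 < m <= M, and [integral_tail_expn_exp] integrates each of them. *)
Lemma integral_MTtail (r : nat) (t : R) : 0 < t ->
  (\int[mu]_(u in `[t, +oo[) (u ^+ r / (expR u - 1))%:E = (MTtail r t)%:E)%E.
Proof.
move=> t0.
pose g M (u : R) := u ^+ r * series (Literm 0 u) M.
have tpos u : u \in `[t, +oo[ -> 0 < u by rewrite in_itv /= andbT; exact: lt_le_trans.
have gI : (\int[mu]_(u in `[t, +oo[) (g M u)%:E)%E @[M --> \oo] -->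
    (\int[mu]_(u in `[t, +oo[) (u ^+ r / (expR u - 1))%:E)%E.
  apply: cvg_integral_nondecreasing => //.
  - move=> M; apply: measurable_funM; last exact: measurable_Liseries.
    by apply: measurable_funTS; exact: exprn_measurable.
  - move=> M u /tpos u0; rewrite mulr_ge0 ?exprn_ge0 ?(ltW u0) //.
    by rewrite /series /= sumr_ge0 // => i _; exact: Literm_ge0.
  - move=> u /tpos u0 M M' MM'; rewrite ler_wpM2l ?exprn_ge0 ?(ltW u0) //.
    exact: nondecreasing_Literm.
  - by move=> u /tpos u0; apply: cvgMr; exact: cvg_Literm0.
suff gT : (\int[mu]_(u in `[t, +oo[) (g M u)%:E)%E @[M --> \oo] --> (MTtail r t)%:E.
  exact: (cvg_unique (@ereal_hausdorff R) gI gT).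
have -> : (fun M => \int[mu]_(u in `[t, +oo[) (g M u)%:E)%E =
    (fun M => (\sum_(i < r.+1) ('C(r, i) * (r - i)`!)%:R * t ^+ i *
      series (Literm (r - i).+1 t) M)%:E).
  apply/funext => M.
  have -> : (\int[mu]_(u in `[t, +oo[) (g M u)%:E = \int[mu]_(u in `[t, +oo[)
      \sum_(0 <= m < M) (u ^+ r * expR (- (m.+1%:R * u)))%:E)%E.
    apply: eq_integral => u _; rewrite sumEFin /g /series /= mulr_sumr.
    by congr EFin; apply: eq_bigr => m _; rewrite /Literm expr0 divr1.
  rewrite ge0_integral_sum //; last 2 first.
  - by move=> m; apply/measurable_EFinP; exact: measurable_expn_exp.
  - by move=> m u /tpos u0; rewrite lee_fin; apply: expn_exp_ge0; exact: ltW.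
  under eq_bigr do rewrite integral_tail_expn_exp ?ltr0n ?(ltW t0) //.
  rewrite sumEFin exchange_big /=; congr EFin; apply: eq_bigr => i _.
  by rewrite /series /= mulr_sumr.
apply: cvg_EFin_seq; apply: cvg_sumr => i _; apply: cvgMr.
exact: cvg_Liexp.
Qed.

End Polylog.

(** * zeta_MT minus L_MT as a tail integral *)

Section MordellTornheimTail.
Variable R : realType.
Notation mu := (@lebesgue_measure R).
Notation D := (`]0%R, +oo[%classic : set R).

(** The substitution x = 1 - exp (- t), under which - log (1 - x) = t. *)
Definition onemexpN (t : R) : R := 1 - expR (- t).

Lemma onemexpN_ge0 t : 0 <= t -> 0 <= onemexpN t.
Proof. by move=> t0; rewrite subr_ge0 expR_le1 oppr_le0. Qed.

Lemma onemexpN_lt1 t : onemexpN t < 1.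
Proof. by rewrite ltrBlDr ltrDl expR_gt0. Qed.

Lemma continuous_onemexpN : continuous onemexpN.
Proof. by move=> t; apply: cvgB; [exact: cvg_cst|exact: continuous_expRN]. Qed.

Lemma continuous_onemexpNX k : continuous (fun u => onemexpN u ^+ k).
Proof.
move=> u; apply: (@continuous_comp R R R onemexpN (fun x => x ^+ k)).
  exact: continuous_onemexpN.
exact: exprn_continuous.
Qed.

Lemma is_derive_onemexpNX k (x : R) :
  is_derive x 1 (fun t => onemexpN t ^+ k.+1 / k.+1%:R) (onemexpN x ^+ k * expR (- x)).
Proof.
have dA : is_derive x 1 onemexpN (expR (- x)).
  apply: (is_derive_eq (is_deriveD (is_derive_cst (1 : R) x 1) (is_derive_opp_expRN x))).
  by rewrite add0r.
have -> : (fun t => onemexpN t ^+ k.+1 / k.+1%:R) = k.+1%:R^-1 \*: onemexpN ^+ k.+1.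
  by apply/funext => t /=; rewrite exprfctE /GRing.scale /= mulrC.
apply: (is_derive_eq (is_deriveZ k.+1%:R^-1 (is_deriveX k.+1 dA))).
by rewrite /GRing.scale /= !mulrA mulVf ?mul1r.
Qed.

(** An antiderivative is (1 - exp (- u))^(k+1) / (k+1), which tends to 1 / (k+1). *)
Lemma integral_tail_onemexpNX k (t : R) : 0 <= t ->
  (\int[mu]_(u in `[t, +oo[) (onemexpN u ^+ k * expR (- u))%:E =
   ((1 - onemexpN t ^+ k.+1) / k.+1%:R)%:E)%E.
Proof.
move=> t0.
have cF : continuous (fun u => onemexpN u ^+ k.+1 / k.+1%:R).
  by move=> u; apply: cvgMl; exact: continuous_onemexpNX.
rewrite (@ge0_continuous_FTC2y R _ (fun u => onemexpN u ^+ k.+1 / k.+1%:R) t (1 / k.+1%:R)).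
- by rewrite -EFinB -mulrBl.
- move=> x tx; rewrite mulr_ge0 ?expR_ge0 // exprn_ge0 // onemexpN_ge0 //.
  exact: le_trans tx.
- apply: continuous_subspaceT => x; apply: cvgM; last exact: continuous_expRN.
  exact: continuous_onemexpNX.
- apply: cvgMl; rewrite -[X in _ --> X](expr1n R k.+1).
  apply: (@cvg_comp _ _ _ onemexpN (fun x => x ^+ k.+1) _ (nbhs (1 : R)));
    last exact: exprn_continuous.
  have : 1 - expR (- u) @[u --> +oo] --> (1 - 0 : R).
    by apply: cvgB; [exact: cvg_cst|exact: cvgr_expR].
  by rewrite subr0.
- by move=> x _; have [] := is_derive_onemexpNX k x.
- by apply: cvg_at_right_filter; exact: cF.
- by move=> x _; rewrite derive1E; have [_ ->] := is_derive_onemexpNX k x.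
Qed.

(** The partial sums of - log (1 - x) at x = 1 - exp (- u); the limit is u. *)
Definition logsum (M : nat) (u : R) : R := \sum_(0 <= j < M) onemexpN u ^+ j.+1 / j.+1%:R.

(** The derivative of u - logsum M u telescopes to (1 - exp (- u))^M; the mean
value theorem on [0, u] gives both bounds. *)
Lemma logsum_bounds M u : 0 < u -> 0 <= u - logsum M u <= u * onemexpN u ^+ M.
Proof.
move=> u0.
have dS (x : R) : is_derive x 1 (fun t : R => t - logsum M t) (onemexpN x ^+ M).
  elim: M => [|M IH].
    rewrite (_ : (fun t => _) = id); last by apply/funext => t; rewrite /logsum big_geq // subr0.
    by rewrite expr0; exact: is_derive_id.
  have -> : (fun t => t - logsum M.+1 t) =
      (fun t => t - logsum M t) - (fun t => onemexpN t ^+ M.+1 / M.+1%:R).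
    by apply/funext => t; rewrite /logsum big_nat_recr //= opprD addrA.
  apply: (is_derive_eq (is_deriveB IH (is_derive_onemexpNX M x))).
  by rewrite exprSr /onemexpN mulrBr mulr1.
have cS : continuous (fun t => t - logsum M t).
  by move=> x; apply/differentiable_continuous/derivable1_diffP; have [] := dS x.
have [c] := MVT u0 (fun x _ => dS x) (continuous_subspaceT cS).
rewrite in_itv /= => /andP[c0 cu].
have -> : logsum M 0 = 0.
  by rewrite /logsum big1 // => j _; rewrite /onemexpN oppr0 expR0 subrr expr0n /= mul0r.
rewrite !subr0 => ->; have Ac := onemexpN_ge0 (ltW c0).
rewrite mulr_ge0 ?exprn_ge0 ?(ltW u0) //= mulrC ler_wpM2l ?(ltW u0) //.
rewrite lerXn2r ?nnegrE ?onemexpN_ge0 ?(ltW u0) ?(ltW c0) //.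
by rewrite /onemexpN lerD2l lerN2 ler_expR lerN2 ltW.
Qed.

Lemma logsum_le M u : 0 < u -> logsum M u <= u.
Proof. by move=> /(logsum_bounds M)/andP[]; rewrite subr_ge0. Qed.

Lemma logsum_ge0 M u : 0 < u -> 0 <= logsum M u.
Proof.
move=> u0; apply: sumr_ge0 => j _.
by rewrite divr_ge0 ?exprn_ge0 ?onemexpN_ge0 ?(ltW u0).
Qed.

Lemma nondecreasing_logsum u : 0 < u -> nondecreasing_seq (logsum^~ u).
Proof.
move=> u0; apply/nondecreasing_seqP => M; rewrite /logsum big_nat_recr //= lerDl.
by rewrite divr_ge0 ?exprn_ge0 ?onemexpN_ge0 ?(ltW u0).
Qed.

Lemma cvg_logsum u : 0 < u -> logsum M u @[M --> \oo] --> u.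
Proof.
move=> u0.
have h : u - logsum M u @[M --> \oo] --> (0 : R).
  apply: (@squeeze_cvgr _ _ _ _ (fun=> 0) (fun M => u * onemexpN u ^+ M)).
  - by near=> M; exact: logsum_bounds.
  - exact: cvg_cst.
  - rewrite -[X in _ --> X](mulr0 u); apply: cvgMr; apply: cvg_expr.
    by rewrite ger0_norm ?onemexpN_lt1 // onemexpN_ge0 ?(ltW u0).
have -> : logsum^~ u = (fun M => u - (u - logsum M u)).
  by apply/funext => M; rewrite opprB addrC subrK.
have hu : u - (u - logsum M u) @[M --> \oo] --> u - 0.
  by apply: cvgB => //; exact: cvg_cst.
by rewrite subr0 in hu.
Unshelve. all: by end_near. Qed.

Lemma measurable_logsum M (A : set R) : measurable_fun A (logsum M).
Proof.
apply: measurable_funTS; apply: continuous_measurable_fun => u.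
apply: cvg_big => [|i _]; first exact: add_continuous.
by apply: cvgMl; exact: continuous_onemexpNX.
Qed.

(** Entries are shifted by one, so this is m_1 + .. + m_n. *)
Definition mtot n (m : {ffun 'I_n -> nat}) : nat := (\sum_i (m i).+1)%N.
Definition mden n (m : {ffun 'I_n -> nat}) : R := \prod_i (m i).+1%:R.

Lemma mtot_gt0 n (m : {ffun 'I_n -> nat}) : (0 < n)%N -> (0 < mtot m)%N.
Proof. by case: n m => // n m _; rewrite /mtot big_ord_recl. Qed.

Lemma mden_gt0 n (m : {ffun 'I_n -> nat}) : 0 < mden m.
Proof. by apply: prodr_gt0 => i _; rewrite ltr0n. Qed.

(** The n-th power of the logarithmic series is the n-fold series defining L_MT,
before the division by m_1 + .. + m_n that an integration produces. *)
Lemma logsum_boxsum n M u :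
  logsum M u ^+ n = boxsum M (fun m : {ffun 'I_n -> nat} => onemexpN u ^+ mtot m / mden m).
Proof.
rewrite -[n in LHS]card_ord -prodr_const -boxsum_prod.
apply: eq_boxsum => m; rewrite /mtot /mden expr_sum -prodfV -big_split /=.
by apply: eq_bigr => i _.
Qed.

(** The difference of the general terms of zeta_(MT,n)(1,..,1;1) and of L_MT at
1 - exp (- t). *)
Definition MTtailterm (t : R) n (m : {ffun 'I_n -> nat}) : R :=
  (1 - onemexpN t ^+ mtot m) / (mden m * (mtot m)%:R).

(** The general term of L_(1,..,1;1)(x); at x = 1, that of
zeta_(MT,n)(1,..,1;1). *)
Definition MTterm (x : R) n (m : {ffun 'I_n -> nat}) : R :=
  x ^+ mtot m / (mden m * (mtot m)%:R).

(** With x = 1 - exp (- u) one has x^k / (exp u - 1) = x^(k-1) exp (- u), which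
[integral_tail_onemexpNX] integrates to (1 - x^k) / k; here k = m_1 + .. + m_n,
and [0 < n] makes it positive. *)
Lemma integral_tail_logsum n M t : (0 < n)%N -> 0 < t ->
  (\int[mu]_(u in `[t, +oo[) (logsum M u ^+ n / (expR u - 1))%:E =
   (boxsum M (@MTtailterm t n))%:E)%E.
Proof.
move=> n0 t0.
have tpos u : u \in `[t, +oo[ -> 0 < u by rewrite in_itv /= andbT; exact: lt_le_trans.
transitivity (\int[mu]_(u in `[t, +oo[) \sum_(f : {ffun 'I_n -> 'I_M})
  ((mden (ffun_nat f))^-1 * (onemexpN u ^+ (mtot (ffun_nat f)).-1 * expR (- u)))%:E)%E.
  apply: eq_integral => u; rewrite inE => /tpos u0.
  rewrite sumEFin logsum_boxsum /boxsum mulr_suml; congr EFin.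
  apply: eq_bigr => f _.
  rewrite -[in LHS](prednK (mtot_gt0 (ffun_nat f) n0)) exprSr.
  have -> : expR (- u) = onemexpN u / (expR u - 1).
    rewrite /onemexpN expRN; field.
    by rewrite (gt_eqF (expR_gt0 u)) (gt_eqF (expR_sub1_gt0 u0)).
  by ring.
have ms k : measurable_fun `[t, +oo[ (fun u => onemexpN u ^+ k * expR (- u)).
  apply: measurable_funTS; apply: continuous_measurable_fun => u.
  apply: cvgM; last exact: continuous_expRN.
  exact: continuous_onemexpNX.
have s0 k u : u \in `[t, +oo[ -> 0 <= onemexpN u ^+ k * expR (- u).
  by move=> /tpos u0; rewrite mulr_ge0 ?expR_ge0 // exprn_ge0 // onemexpN_ge0 ?(ltW u0).
rewrite ge0_integral_sum //; last 2 first.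
- move=> f; apply/measurable_EFinP; apply: measurable_funM => //; exact: ms.
- move=> f u ut; rewrite lee_fin mulr_ge0 ?s0 //.
  by rewrite invr_ge0 ltW // mden_gt0.
rewrite /boxsum -sumEFin; apply: eq_bigr => f _.
under eq_integral do rewrite EFinM.
rewrite ge0_integralZl_EFin //; last 3 first.
- by move=> u ut; rewrite lee_fin s0.
- by apply/measurable_EFinP; exact: ms.
- by rewrite invr_ge0 ltW // mden_gt0.
rewrite integral_tail_onemexpNX ?(ltW t0) // prednK ?mtot_gt0 // -EFinM; congr EFin.
by rewrite /MTtailterm invfM; ring.
Qed.

(** Both sides are the integral of u^n / (exp u - 1) over [t, oo[: the left one by
monotone convergence of [logsum] to u, the right one by [integral_MTtail]. *)
Lemma cvg_MTtailterm n t : (0 < n)%N -> 0 < t ->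
  boxsum M (@MTtailterm t n) @[M --> \oo] --> MTtail n t.
Proof.
move=> n0 t0.
have tpos u : u \in `[t, +oo[ -> 0 < u by rewrite in_itv /= andbT; exact: lt_le_trans.
suff h : (boxsum M (@MTtailterm t n))%:E @[M --> \oo] --> (MTtail n t)%:E.
  by have := fine_cvg h; apply.
rewrite -integral_MTtail //.
under eq_cvg do rewrite -integral_tail_logsum //.
apply: cvg_integral_nondecreasing => //.
- move=> M; apply: measurable_funM.
    by apply: measurable_funX; exact: measurable_logsum.
  apply: (eq_measurable_fun (Liexp 0)).
    by move=> u; rewrite inE => /tpos u0; rewrite Liexp0.
  apply: (measurable_funS _ _ (@measurable_Liexp R 0)) => //.
  by move=> u /tpos u0; rewrite /= in_itv /= andbT.
- move=> M u /tpos u0; rewrite divr_ge0 ?(ltW (expR_sub1_gt0 u0)) // exprn_ge0 //.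
  exact: logsum_ge0.
- move=> u /tpos u0 M M' MM'.
  rewrite ler_wpM2r ?invr_ge0 ?(ltW (expR_sub1_gt0 u0)) //.
  rewrite lerXn2r ?nnegrE ?logsum_ge0 //.
  exact: nondecreasing_logsum.
- move=> u /tpos u0; apply: cvgMl.
  apply: (@cvg_comp _ _ _ (logsum^~ u) (fun x => x ^+ n) _ (nbhs u)); last exact: exprn_continuous.
  exact: cvg_logsum.
Qed.

Lemma MTterm_ge0 x n (m : {ffun 'I_n -> nat}) : 0 <= x -> 0 <= MTterm x m.
Proof.
move=> x0; rewrite divr_ge0 ?exprn_ge0 // mulr_ge0 //.
by rewrite ltW // mden_gt0.
Qed.

(** Forgetting the factor 1 / (m_1 + .. + m_n) <= 1 leaves the n-th power of
[logsum], which is at most t^n. *)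
Lemma is_cvg_MTterm n t : (0 < n)%N -> 0 < t ->
  cvgn (fun M => boxsum M (@MTterm (onemexpN t) n)).
Proof.
move=> n0 t0; apply: nondecreasing_is_cvgn.
  by apply: nondecreasing_boxsum => m; apply: MTterm_ge0; rewrite onemexpN_ge0 ?(ltW t0).
exists (t ^+ n) => _ [M _ <-].
have := lerXn2r n (_ : logsum M t \is Num.nneg) (_ : t \is Num.nneg) (logsum_le M t0).
rewrite !nnegrE logsum_ge0 ?(ltW t0) // => /(_ isT isT); apply: le_trans.
rewrite logsum_boxsum; apply: le_boxsum => m.
rewrite /MTterm ler_wpM2l ?exprn_ge0 ?onemexpN_ge0 ?(ltW t0) //.
rewrite lef_pV2 ?posrE ?mden_gt0 //; last by rewrite mulr_gt0 ?mden_gt0 // ltr0n mtot_gt0.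
by rewrite ler_peMr ?(ltW (mden_gt0 m)) // ler1n mtot_gt0.
Qed.

(** The value zeta_(MT,n)(1,..,1;1). *)
Definition zetaMT1 n : R := limn (fun M => boxsum M (@MTterm 1 n)).

Lemma MTtermD t n (m : {ffun 'I_n -> nat}) :
  MTterm 1 m = MTterm (onemexpN t) m + MTtailterm t m.
Proof. by rewrite /MTterm /MTtailterm -mulrDl expr1n addrC subrK. Qed.

(** At x = 1 the series is the sum of the series at 1 - exp (- 1) and of a series
computed by a finite tail integral; this proves its convergence. *)
Lemma cvg_zetaMT1 n : (0 < n)%N -> boxsum M (@MTterm 1 n) @[M --> \oo] --> zetaMT1 n.
Proof.
move=> n0.
suff : cvgn (fun M => boxsum M (@MTterm 1 n)) by [].
have -> : (fun M => boxsum M (@MTterm 1 n)) =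
    (fun M => boxsum M (@MTterm (onemexpN 1) n) + boxsum M (@MTtailterm 1 n)).
  by apply/funext => M; rewrite -boxsumD; apply: eq_boxsum => m; exact: MTtermD.
by apply: is_cvgD; [exact: is_cvg_MTterm|apply: cvgP; exact: cvg_MTtailterm].
Qed.

Lemma cvg_MTterm n t : (0 < n)%N -> 0 < t ->
  boxsum M (@MTterm (onemexpN t) n) @[M --> \oo] --> zetaMT1 n - MTtail n t.
Proof.
move=> n0 t0.
have -> : (fun M => boxsum M (@MTterm (onemexpN t) n)) =
    (fun M => boxsum M (@MTterm 1 n) - boxsum M (@MTtailterm t n)).
  apply/funext => M; apply/eqP; rewrite eq_sym subr_eq -boxsumD; apply/eqP.
  by apply: eq_boxsum => m; exact: MTtermD.
by apply: cvgB; [exact: cvg_zetaMT1|exact: cvg_MTtailterm].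
Qed.

End MordellTornheimTail.

(** * Mellin transforms and values at real s *)

Section MellinTransform.
Variable R : realType.
Notation mu := (@lebesgue_measure R).
Notation D := (`]0%R, +oo[%classic : set R).

Lemma itv0y_gt0 t : D t -> 0 < t.
Proof. by rewrite /= in_itv /= andbT. Qed.

Lemma Rintegral_sum (A : set R) (I : Type) (r : seq I) (P : pred I) (f : I -> R -> R) :
  measurable A -> (forall i, P i -> mu.-integrable A (EFin \o f i)) ->
  \int[mu]_(x in A) (\sum_(i <- r | P i) f i x) =
  \sum_(i <- r | P i) \int[mu]_(x in A) f i x.
Proof.
move=> mA fi; elim: r => [|i r IH].
  rewrite big_nil; under eq_Rintegral do rewrite big_nil.
  by rewrite Rintegral_cst // mul0r.
rewrite big_cons; under eq_Rintegral do rewrite big_cons.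
case: ifPn => // Pi; rewrite RintegralD ?IH //; first exact: fi.
rewrite (_ : EFin \o _ = (fun x => \sum_(j <- r | P j) (f j x)%:E)%E).
  exact: integrable_sum.
by apply/funext => x /=; rewrite sumEFin.
Qed.

(** Gamma at real arguments [s >= 1]. *)
Definition rGamma (s : R) : R := fine (eGamma s).

Lemma eGammaE s : 1 <= s -> eGamma s = (rGamma s)%:E.
Proof.
move=> s1; rewrite /rGamma fineK // ge0_fin_numE ?eGamma_lty //.
by apply: ltW; exact: eGamma_gt0.
Qed.

Lemma rGamma_gt0 s : 1 <= s -> 0 < rGamma s.
Proof. by move=> s1; rewrite -lte_fin -eGammaE // eGamma_gt0. Qed.

Lemma rGammaS s : 1 <= s -> rGamma (s + 1) = s * rGamma s.
Proof.
move=> s1; apply: EFin_inj; rewrite -eGammaE; last by apply: ler_wpDr.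
by rewrite eGammaS // eGammaE // EFinM.
Qed.

Lemma rGammaD_poch s n : 1 <= s -> rGamma (s + n%:R) = poch s n * rGamma s.
Proof.
move=> s1; elim: n => [|n IH]; first by rewrite addr0 /poch big_nil mul1r.
rewrite -natr1 addrA rGammaS ?IH; last by apply: ler_wpDr.
by rewrite /poch big_nat_recr //=; ring.
Qed.

(** The general term of zeta_MT (k_1, .., k_n; s). *)
Definition zterm n (k : 'I_n -> nat) (s : R) (m : {ffun 'I_n -> nat}) : R :=
  (\prod_i (m i).+1%:R ^+ k i)^-1 * (mtot m)%:R `^ (- s).

(** The integrand of the Mellin transform of the product of the polylogarithms
Li_(k_i)(exp (- t)). *)
Definition mellin (s : R) n (k : 'I_n -> nat) (t : R) : R :=
  t `^ (s - 1) * \prod_i Liexp (k i) t.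

(** The kernel t^(s-1) / (exp t - 1): Li_0(exp (- t)) = 1 / (exp t - 1). *)
Definition mellin_kernel (s t : R) : R := t `^ (s - 1) * Liexp 0 t.

Lemma zterm_ge0 n (k : 'I_n -> nat) s m : 0 <= zterm k s m.
Proof.
by rewrite mulr_ge0 ?powR_ge0 // invr_ge0 prodr_ge0 // => i _; rewrite exprn_ge0.
Qed.

(** The truncated product of polylogarithms is a finite sum of exponentials
exp (- (m_1 + .. + m_n) t), each of which Euler's integral evaluates. *)
Lemma cvg_boxsum_mellin n (k : 'I_n -> nat) s : (0 < n)%N -> 1 <= s ->
  (boxsum M (zterm k s) * rGamma s)%:E @[M --> \oo] -->
  (\int[mu]_(t in D) (mellin s k t)%:E)%E.
Proof.
move=> n0 s1.
have s0 : 0 < s by exact: lt_le_trans s1.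
pose g M t := t `^ (s - 1) * \prod_i series (Literm (k i) t) M.
have -> : (fun M => (boxsum M (zterm k s) * rGamma s)%:E) =
          (fun M => \int[mu]_(t in D) (g M t)%:E)%E.
  apply/funext => M; apply/esym.
  transitivity (\int[mu]_(t in D) \sum_(f : {ffun 'I_n -> 'I_M})
    ((\prod_i (ffun_nat f i).+1%:R ^+ k i)^-1 *
      (t `^ (s - 1) * expR (- ((mtot (ffun_nat f))%:R * t))))%:E)%E.
    apply: eq_integral => t _; rewrite sumEFin; congr EFin.
    rewrite /g /series /= -boxsum_prod /boxsum mulr_sumr; apply: eq_bigr => f _.
    rewrite big_split /= prodfV mulrA mulrC; congr (_ * (_ * _)).
    rewrite -expR_sum; congr expR; rewrite /mtot natr_sum mulr_suml.
    by rewrite -sumrN.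
  have c0 (f : {ffun 'I_n -> 'I_M}) : 0 <= (\prod_i (ffun_nat f i).+1%:R ^+ k i)^-1 :> R.
    by rewrite invr_ge0 prodr_ge0 // => i _; rewrite exprn_ge0.
  rewrite ge0_integral_sum //; last 2 first.
  - by move=> f; apply/measurable_EFinP; apply: measurable_funM => //; exact: measurable_powR_exp.
  - by move=> f t _; rewrite lee_fin mulr_ge0 ?powR_exp_ge0.
  rewrite /boxsum mulr_suml -sumEFin; apply: eq_bigr => f _.
  under eq_integral do rewrite EFinM.
  rewrite ge0_integralZl_EFin //; last 2 first.
  - by move=> t _; rewrite lee_fin powR_exp_ge0.
  - by apply/measurable_EFinP; exact: measurable_powR_exp.
  rewrite integral_powR_exp //; last by rewrite ltr0n mtot_gt0.
  by rewrite eGammaE // -!EFinM /zterm mulrA.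
apply: cvg_integral_nondecreasing => //.
- move=> M; apply: measurable_funM; first by apply: measurable_funTS; exact: measurable_powR.
  by apply: measurable_prod => i _; exact: measurable_Liseries.
- move=> M t /itv0y_gt0 t0; rewrite mulr_ge0 ?powR_ge0 // prodr_ge0 // => i _.
  by rewrite /series /= sumr_ge0 // => j _; exact: Literm_ge0.
- move=> t /itv0y_gt0 t0 M M' MM'; rewrite ler_wpM2l ?powR_ge0 //.
  apply: ler_prod => i _; rewrite nondecreasing_Literm // andbT.
  by rewrite /series /= sumr_ge0 // => j _; exact: Literm_ge0.
- move=> t /itv0y_gt0 t0; apply: cvgMr; apply: cvg_prodr => i _.
  exact: cvg_Liexp.
Qed.

Lemma cvg_boxsum_zterm n (k : 'I_n -> nat) s : (0 < n)%N -> 1 <= s ->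
  mu.-integrable D (EFin \o mellin s k) ->
  boxsum M (zterm k s) @[M --> \oo] --> (rGamma s)^-1 * \int[mu]_(t in D) mellin s k t.
Proof.
move=> n0 s1 mi.
have g0 := rGamma_gt0 s1.
have h := @cvg_boxsum_mellin n k s n0 s1.
have If : (\int[mu]_(t in D) (mellin s k t)%:E)%E \is a fin_num.
  exact: integrable_fin_num mi.
rewrite -(fineK If) in h.
have {}h : boxsum M (zterm k s) * rGamma s @[M --> \oo] --> \int[mu]_(t in D) mellin s k t.
  by have := fine_cvg h; apply.
have -> : (fun M => boxsum M (zterm k s)) =
          (fun M => (rGamma s)^-1 * (boxsum M (zterm k s) * rGamma s)).
  by apply/funext => M; rewrite mulrC mulfK // gt_eqF.
by apply: cvgMr.
Qed.

Lemma cpow_real (x s : R) : cpow x s%:C = (x `^ s)%:C.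
Proof. by rewrite /cpow /= mul0r cos0 sin0 [_ * _](mulr1 (x `^ s)%:C). Qed.

Lemma zetaMT_series_real (k : seq nat) (s : R) : (0 < size k)%N -> 1 <= s ->
  mu.-integrable D (EFin \o mellin s (fun i : 'I_(size k) => nth 0%N k i)) ->
  zetaMT_series k s%:C =
  ((rGamma s)^-1 * \int[mu]_(t in D) mellin s (fun i : 'I_(size k) => nth 0%N k i) t)%:C.
Proof.
move=> k0 s1 mi; rewrite /zetaMT_series.
rewrite -(usum_boxsum _ (cvg_boxsum_zterm k0 s1 mi)); last exact: zterm_ge0.
congr usum; apply/funext => m.
rewrite -/(mtot m).
rewrite cpow_real /zterm invfM powRN rmorphM /= !fmorphV /= rmorph_prod /=.
congr ((\prod_i _)^-1 * _); apply/funext => i.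
by rewrite rmorphXn /= rmorph_nat.
Qed.

(** The case n = 1, k = 0 of [cvg_boxsum_zterm], with tuples of length one unpacked. *)
Lemma riemann_zeta_real (s : R) : 1 <= s ->
  mu.-integrable D (EFin \o mellin_kernel s) ->
  usum (fun n : nat => (cpow (n.+1%:R : R) s%:C)^-1) =
  ((rGamma s)^-1 * \int[mu]_(t in D) mellin_kernel s t)%:C.
Proof.
move=> s1.
have -> : mellin_kernel s = mellin s (fun _ : 'I_1 => 0%N).
  by apply/funext => t; rewrite /mellin big_ord1.
move=> mi.
have -> : (fun n : nat => (cpow (n.+1%:R : R) s%:C)^-1) = (fun n => (n.+1%:R `^ (- s))%:C).
  by apply/funext => n; rewrite cpow_real powRN fmorphV.
apply: usum_nat; first by move=> n; exact: powR_ge0.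
apply: cvg_trans (cvg_boxsum_zterm (ltn0Sn 0) s1 mi).
apply: near_eq_cvg; near=> M.
transitivity (boxsum M (fun m : {ffun 'I_1 -> nat} => \prod_i (m i).+1%:R `^ (- s))).
  by apply: eq_boxsum => m; rewrite /zterm /mtot !big_ord1 expr0 invr1 mul1r.
by rewrite (boxsum_prod M (fun _ j => j.+1%:R `^ (- s))) big_ord1.
Unshelve. all: by end_near. Qed.

Lemma cint0oo_real (f : R -> R[i]) (g : R -> R) : (forall t, 0 < t -> f t = (g t)%:C) ->
  cint0oo f = (\int[mu]_(t in D) g t)%:C.
Proof.
move=> fg; rewrite /cint0oo.
have -> : \int[mu]_(t in D) complex.Re (f t) = \int[mu]_(t in D) g t.
  by apply: eq_Rintegral => t; rewrite inE => /itv0y_gt0 t0; rewrite fg.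
have -> // : \int[mu]_(t in D) complex.Im (f t) = 0.
transitivity (\int[mu]_(t in D) (cst 0 t)).
  by apply: eq_Rintegral => t; rewrite inE => /itv0y_gt0 t0; rewrite fg.
by rewrite Rintegral_cst // mul0r.
Qed.

Lemma Gamma_real (s : R) : 1 <= s -> Gamma s%:C = (rGamma s)%:C.
Proof.
move=> s1; rewrite /Gamma /= (lt_le_trans ltr01 s1) addr0.
rewrite /poch big_nil divr1 /Gamma_euler.
rewrite (@cint0oo_real _ (fun t => t `^ (s - 1) * expR (- t))) //.
by move=> t _; rewrite -rmorphB /= cpow_real rmorphM.
Qed.

(** Near infinity and near 0 at once, 1 / (exp t - 1) <= 2 exp (- t / 2) / t, and
t^(s-2) exp (- t / 2) is covered by Euler's integral when s - 1 >= 1. *)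
Lemma integrable_mellin_kernel (s : R) : 2 <= s ->
  mu.-integrable D (EFin \o mellin_kernel s).
Proof.
move=> s2.
have s1 : 1 <= s - 1 by rewrite lerBrDr.
have mb : measurable_fun D (mellin_kernel s).
  apply: measurable_funM; first by apply: measurable_funTS; exact: measurable_powR.
  exact: measurable_Liexp.
apply/integrableP; split; first exact/measurable_EFinP.
apply: (@le_lt_trans _ _
  (\int[mu]_(t in D) (2%:E * (t `^ (s - 1 - 1) * expR (- (2^-1 * t)))%:E))%E).
  apply: ge0_le_integral => //.
  - by apply: measurableT_comp => //; exact/measurable_EFinP.
  - by apply/measurable_EFinP; apply: measurable_funM => //; exact: measurable_powR_exp.
  move=> t /itv0y_gt0 t0; rewrite /= -EFinM lee_fin /mellin_kernel.
  rewrite ger0_norm ?mulr_ge0 ?powR_ge0 ?Liexp_ge0 // Liexp0 //.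
  have -> : t `^ (s - 1) = t * t `^ (s - 1 - 1).
    by rewrite mulr_powRB1 ?(ltW t0) // (lt_le_trans _ s1).
  rewrite ler_pdivrMr ?expR_sub1_gt0 // [leLHS]mulrC.
  rewrite (_ : 2 * _ * _ =
    t `^ (s - 1 - 1) * (2 * (expR (- (2^-1 * t)) * (expR t - 1)))); last by ring.
  rewrite ler_wpM2l ?powR_ge0 //.
  set e := expR (2^-1 * t).
  have e0 : 0 < e by exact: expR_gt0.
  have eE : expR t = e * e by rewrite /e -expRD; congr expR; field.
  rewrite expRN -/e eE.
  have te : t <= 2 * (e - 1).
    rewrite -ler_pdivrMl // lerBrDl; exact: expR_ge1Dx.
  have -> : 2 * (e^-1 * (e * e - 1)) = 2 * (e - 1) * (1 + e^-1).
    by field; rewrite gt_eqF.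
  apply: (le_trans te); rewrite ler_peMr ?lerDl ?invr_ge0 ?(ltW e0) //.
  by rewrite mulr_ge0 // subr_ge0 -expR0 ler_expR mulr_ge0 ?(ltW t0) // invr_ge0.
rewrite ge0_integralZl_EFin //; last 2 first.
- by move=> t _; rewrite lee_fin powR_exp_ge0.
- by apply/measurable_EFinP; exact: measurable_powR_exp.
rewrite integral_powR_exp // ?invr_gt0 // eGammaE // -!EFinM ltry //.
Qed.

Lemma zetaMT_series_ones n : (0 < n)%N ->
  zetaMT_series (nseq n 1%N) (1 : R[i]) = (zetaMT1 R n)%:C.
Proof.
move=> n0; rewrite /zetaMT_series.
have sz : (0 < size (nseq n 1%N))%N by rewrite size_nseq.
rewrite -[in RHS](size_nseq n 1%N).
rewrite -(usum_boxsum _ (@cvg_zetaMT1 R _ sz)); last by move=> m; exact: MTterm_ge0.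
congr usum; apply/funext => m.
rewrite -/(mtot m).
rewrite -[X in cpow _ X]/(1%:C) cpow_real powRr1 ?ler0n //.
rewrite /MTterm expr1n mul1r fmorphV rmorphM /= /mden rmorph_prod /=.
congr ((_ * _)^-1); apply: eq_bigr => i _.
have ltin : (i < n)%N by have := ltn_ord i; rewrite [X in (_ < X)%N]size_nseq.
by rewrite nth_nseq ltin expr1 rmorph_nat.
Qed.

Lemma L_MT_ones n (t : R) : (0 < n)%N -> 0 < t ->
  L_MT (ones_index n) (1 - expR (- t))%:C = (zetaMT1 R n - MTtail n t)%:C.
Proof.
move=> n0 t0; rewrite /L_MT /=.
have sz : (0 < size (nseq n 1%N))%N by rewrite size_nseq.
rewrite -[in RHS](size_nseq n 1%N).
rewrite -(usum_boxsum _ (cvg_MTterm sz t0)); last first.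
  by move=> m; apply: MTterm_ge0; apply: onemexpN_ge0; exact: ltW.
congr usum; apply/funext => m.
rewrite /MTterm rmorphM /= rmorphXn /= fmorphV rmorphM /= /mden rmorph_prod /=.
congr (_ / (_ * _)); last by rewrite expr1 rmorph_nat.
apply: eq_bigr => i _.
have ltin : (i < n)%N by have := ltn_ord i; rewrite [X in (_ < X)%N]size_nseq.
by rewrite nth_nseq ltin expr1 rmorph_nat.
Qed.

End MellinTransform.

(** * Both sides at real s *)

(** This removes the outer sum over n from both sides of the identity: n is the
cardinality of J on one side and the sum of the i_j on the other. *)
Lemma sum_by_degree (V : nmodType) (T : finType) (P : pred T) (d : T -> nat) (K : nat)
    (F : nat -> T -> V) : (forall x, P x -> (d x <= K)%N) ->
  \sum_(0 <= n < K.+1) \sum_(x | P x && (d x == n)) F n x = \sum_(x | P x) F (d x) x.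
Proof.
move=> dK; rewrite big_mkord.
rewrite (partition_big (fun x => inord (d x) : 'I_K.+1) xpredT) //=.
apply: eq_bigr => n _; apply: eq_big => [x|x /andP[_ /eqP <-] //].
case Px : (P x) => //=; apply/eqP/eqP => [->|<-]; first by rewrite inord_val.
by rewrite inordK // ltnS dK.
Qed.

Section RealPoints.
Variable R : realType.
Notation mu := (@lebesgue_measure R).
Notation D := (`]0%R, +oo[%classic : set R).

Lemma MTtail_ge0 n (t : R) : 0 < t -> 0 <= MTtail n t.
Proof.
move=> t0; apply: sumr_ge0 => i _.
by rewrite !mulr_ge0 ?Liexp_ge0 // exprn_ge0 // ltW.
Qed.

(** The difference is the value of L_MT, a series of nonnegative terms. *)
Lemma MTtail_le_zetaMT1 n (t : R) : (0 < n)%N -> 0 < t -> MTtail n t <= zetaMT1 R n.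
Proof.
move=> n0 t0; rewrite -subr_ge0.
have x0 := onemexpN_ge0 (ltW t0).
have nd := nondecreasing_boxsum (fun m => @MTterm_ge0 R (onemexpN t) n m x0).
have := nondecreasing_cvgn_le nd (cvgP _ (cvg_MTterm n0 t0)) 0%N.
rewrite (cvg_lim _ (cvg_MTterm n0 t0)) //; apply: le_trans.
by apply: boxsum_ge0 => m; exact: MTterm_ge0.
Qed.

Lemma measurable_MTtail n : measurable_fun D (@MTtail R n).
Proof.
apply: measurable_sum => i; apply: measurable_funM; last exact: measurable_Liexp.
exact: measurable_funM.
Qed.

(** A single term of the closed form, without its coefficient: this bound makes the
terms of the expanded product integrable one by one. *)
Lemma Liexp_le_MTtail n a (t : R) : (a <= n)%N -> 0 < t ->
  t ^+ a * Liexp (n - a).+1 t <= MTtail n t.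
Proof.
move=> an t0.
pose i0 : 'I_n.+1 := Ordinal (an : (a < n.+1)%N).
have pos (i : nat) : 0 <= t ^+ i * Liexp (n - i).+1 t.
  by rewrite mulr_ge0 ?Liexp_ge0 // exprn_ge0 // ltW.
rewrite /MTtail (bigD1 i0) //=; apply: ler_wpDr.
  by apply: sumr_ge0 => i _; rewrite -mulrA mulr_ge0.
rewrite -mulrA ler_peMl // ler1n muln_gt0 fact_gt0 bin_gt0 andbT //.
Qed.

Lemma integrable_mellin_kernelM (s C : R) (h : R -> R) : 2 <= s ->
  measurable_fun D h -> (forall t, 0 < t -> `|h t| <= C) ->
  mu.-integrable D (EFin \o (fun t => mellin_kernel s t * h t)).
Proof.
move=> s2 mh hC.
have mb : measurable_fun D (mellin_kernel s).
  apply: measurable_funM; first by apply: measurable_funTS; exact: measurable_powR.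
  exact: measurable_Liexp.
have gi : mu.-integrable D (fun t => C%:E * (mellin_kernel s t)%:E)%E.
  by apply: integrableZl => //; exact: integrable_mellin_kernel.
apply: le_integrable gi => //.
  by apply/measurable_EFinP; exact: measurable_funM.
move=> t /itv0y_gt0 t0; rewrite /= lee_fin !normrM mulrC ler_wpM2r //.
by apply: (le_trans (hC _ t0)); exact: ler_norm.
Qed.

Variables (N : nat) (r : 'I_N -> nat).
Hypothesis r_gt0 : forall j, (0 < r j)%N.

Definition Lprod (J : {set 'I_N}) (t : R) : R :=
  \prod_(j in J) (zetaMT1 R (r j) - MTtail (r j) t).

Lemma integrable_Lprod s (J : {set 'I_N}) : 2 <= s ->
  mu.-integrable D (EFin \o (fun t => mellin_kernel s t * Lprod J t)).
Proof.
move=> s2; apply: (@integrable_mellin_kernelM s (\prod_(j in J) zetaMT1 R (r j))) => //.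
  rewrite (_ : Lprod J = fun t => \prod_(j <- enum J) (zetaMT1 R (r j) - MTtail (r j) t)).
    apply: measurable_prod => j _; apply: measurable_funB => //.
    exact: measurable_MTtail.
  by apply/funext => t; rewrite /Lprod big_enum.
move=> t t0; rewrite /Lprod normr_prod; apply: ler_prod => j _.
have lt := MTtail_le_zetaMT1 (r_gt0 j) t0.
by rewrite normr_ge0 /= ger0_norm ?subr_ge0 // gerBl MTtail_ge0.
Qed.

(** Expansion of the product over j of
MTtail (r j) t = - (zetaMT1 (r j) - MTtail (r j) t) + zetaMT1 (r j). *)
Lemma sum_Lprod s : 2 <= s ->
  \sum_(0 <= n < N.+1) (-1) ^+ n * \sum_(J : {set 'I_N} | #|J| == n)
     (\prod_(j in ~: J) zetaMT1 R (r j)) * \int[mu]_(t in D) (mellin_kernel s t * Lprod J t) =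
  \int[mu]_(t in D) (mellin_kernel s t * \prod_j MTtail (r j) t).
Proof.
move=> s2.
under eq_bigr do rewrite mulr_sumr.
rewrite (@sum_by_degree _ _ xpredT (fun J : {set 'I_N} => #|J|) N
  (fun n J => (-1) ^+ n * ((\prod_(j in ~: J) zetaMT1 R (r j)) *
     \int[mu]_(t in D) (mellin_kernel s t * Lprod J t)))); last first.
  by move=> J _; rewrite -[N in leqRHS]card_ord max_card.
under eq_bigr do rewrite mulrA -RintegralZl ?integrable_Lprod //.
rewrite -Rintegral_sum //; last first.
  move=> J _; rewrite (_ : EFin \o _ =
    (fun t => ((-1) ^+ #|J| * \prod_(j in ~: J) zetaMT1 R (r j))%:E *
       (mellin_kernel s t * Lprod J t)%:E)%E) //.
  by apply: integrableZl => //; exact: integrable_Lprod.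
apply: eq_Rintegral => t _.
have -> : \prod_j MTtail (r j) t =
    \prod_j (- (zetaMT1 R (r j) - MTtail (r j) t) + zetaMT1 R (r j)).
  by apply: eq_bigr => j _; rewrite opprB subrK.
rewrite bigA_distr mulr_sumr; apply: eq_big => [J|J _]; first by rewrite inE.
suff -> : \prod_i (if i \in J then - (zetaMT1 R (r i) - MTtail (r i) t) else zetaMT1 R (r i)) =
    (-1) ^+ #|J| * Lprod J t * \prod_(j in ~: J) zetaMT1 R (r j) by ring.
rewrite (bigID (mem J)) /= /Lprod -prodrN; congr (_ * _).
  by apply: eq_bigr => j ->.
by apply: eq_big => [j|j /negbTE ->] //; rewrite inE.
Qed.

Definition total_weight := (\sum_j r j)%N.

Definition total_deg (i : {ffun 'I_N -> 'I_total_weight.+1}) : nat := (\sum_l i l)%N.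
Definition tail_coef (i : {ffun 'I_N -> 'I_total_weight.+1}) : R :=
  \prod_j ('C(r j, i j) * (r j - i j)`!)%N%:R.
Definition Liprod (i : {ffun 'I_N -> 'I_total_weight.+1}) (t : R) : R :=
  t ^+ total_deg i * \prod_j Liexp (r j - i j).+1 t.

Lemma LiprodE i t : Liprod i t = \prod_j (t ^+ i j * Liexp (r j - i j).+1 t).
Proof. by rewrite big_split /= -expr_sum. Qed.

Lemma integrable_Liprod s (i : {ffun 'I_N -> 'I_total_weight.+1}) : 2 <= s ->
  [forall l, (i l <= r l)%N] ->
  mu.-integrable D (EFin \o (fun t => mellin_kernel s t * Liprod i t)).
Proof.
move=> s2 /forallP ir; apply: (@integrable_mellin_kernelM s (\prod_j zetaMT1 R (r j))) => //.
  apply: measurable_funM; first by apply: measurable_funTS; exact: exprn_measurable.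
  by apply: measurable_prod => j _; exact: measurable_Liexp.
move=> t t0; rewrite LiprodE normr_prod; apply: ler_prod => j _.
rewrite normr_ge0 /= ger0_norm; last first.
  by rewrite mulr_ge0 ?Liexp_ge0 // exprn_ge0 // ltW.
apply: le_trans (Liexp_le_MTtail _ t0) (MTtail_le_zetaMT1 _ t0) => //.
Qed.

Lemma prod_MTtail t : \prod_j MTtail (r j) t =
  \sum_(i : {ffun 'I_N -> 'I_total_weight.+1} | [forall l, (i l <= r l)%N])
     tail_coef i * Liprod i t.
Proof.
transitivity (\prod_j \sum_(a < total_weight.+1 | (a <= r j)%N)
   ('C(r j, a) * (r j - a)`!)%:R * t ^+ a * Liexp (r j - a).+1 t).
  apply: eq_bigr => j _; rewrite /MTtail.
  rewrite (big_ord_widen total_weight.+1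
    (fun a => ('C(r j, a) * (r j - a)`!)%:R * t ^+ a * Liexp (r j - a).+1 t)) //.
  by rewrite ltnS /total_weight (bigD1 j) //= leq_addr.
rewrite bigA_distr_big_dep; apply: eq_big => [i|i _].
  by apply/familyP/forallP.
rewrite LiprodE /tail_coef -big_split /=.
by apply: eq_bigr => j _; rewrite mulrA.
Qed.

(** Expansion of the product over j of the closed forms of [MTtail (r j)]. *)
Lemma sum_Liprod s : 2 <= s ->
  \sum_(0 <= n < total_weight.+1) \sum_(i : {ffun 'I_N -> 'I_total_weight.+1} |
       [forall l, (i l <= r l)%N] && (total_deg i == n))
    tail_coef i * \int[mu]_(t in D) (mellin_kernel s t * Liprod i t) =
  \int[mu]_(t in D) (mellin_kernel s t * \prod_j MTtail (r j) t).
Proof.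
move=> s2.
rewrite (@sum_by_degree _ _
  (fun i : {ffun 'I_N -> 'I_total_weight.+1} => [forall l, (i l <= r l)%N])
  total_deg total_weight
  (fun _ i => tail_coef i * \int[mu]_(t in D) (mellin_kernel s t * Liprod i t))); last first.
  by move=> i /forallP ir; apply: leq_sum => l _.
under eq_bigr => i ir do rewrite -RintegralZl ?integrable_Liprod //.
rewrite -Rintegral_sum //; last first.
  move=> i ir; rewrite (_ : EFin \o _ =
    (fun t => (tail_coef i)%:E * (mellin_kernel s t * Liprod i t)%:E)%E) //.
  by apply: integrableZl => //; exact: integrable_Liprod.
apply: eq_Rintegral => t _; rewrite prod_MTtail mulr_sumr.
by apply: eq_bigr => i _; rewrite mulrCA.
Qed.

(** The last index 0 contributes Li_0(exp (- t)) = 1 / (exp t - 1), and the factor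
t^n shifts s by n. *)
Lemma zetaMT_series_Liprod s (i : {ffun 'I_N -> 'I_total_weight.+1}) : 2 <= s ->
  [forall l, (i l <= r l)%N] ->
  zetaMT_series (rcons [seq (r j - i j + 1)%N | j <- enum 'I_N] 0%N) (s%:C + (total_deg i)%:R) =
  ((rGamma (s + (total_deg i)%:R))^-1 * \int[mu]_(t in D) (mellin_kernel s t * Liprod i t))%:C.
Proof.
move=> s2 ir; set ks := rcons _ _.
have sz : (0 < size ks)%N by rewrite size_rcons.
have s1 : 1 <= s + (total_deg i)%:R.
  by apply: ler_wpDr => //; apply: le_trans s2; rewrite ler1n.
have mE : {in D, mellin (s + (total_deg i)%:R) (fun j : 'I_(size ks) => nth 0%N ks j)
    =1 fun t => mellin_kernel s t * Liprod i t}.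
  move=> t; rewrite inE => /itv0y_gt0 t0.
  rewrite /mellin -(big_mkord xpredT (fun j => Liexp (nth 0%N ks j) t)).
  rewrite -(big_nth 0%N xpredT (fun k => Liexp k t)) /ks -cats1 big_cat /= big_seq1.
  rewrite big_map big_enum /= /mellin_kernel /Liprod.
  rewrite (eq_bigr (fun j => Liexp (r j - i j).+1 t)); last by move=> j _; rewrite addn1.
  rewrite addrAC (_ : t `^ (s - 1 + _) = t `^ (s - 1) * t `^ (total_deg i)%:R).
    by rewrite powR_mulrn ?(ltW t0) //; ring.
  by rewrite powRD // (gt_eqF t0) implybT.
have -> : s%:C + (total_deg i)%:R = (s + (total_deg i)%:R)%:C by rewrite rmorphD /= rmorph_nat.
rewrite zetaMT_series_real //; last first.
  apply: eq_integrable (integrable_Liprod s2 ir) => // t Dt /=.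
  by rewrite mE.
by congr ((_ * _)%:C); apply: eq_Rintegral => t Dt; exact: mE.
Qed.

(** When J is empty, xi is the Riemann zeta function, whose value has the same
integral form with an empty product. *)
Lemma xiMT_ones (X : R[i] -> R[i]) (J : {set 'I_N}) s : 2 <= s ->
  is_xiMT [seq ones_index (r j) | j <- enum J] X ->
  X s%:C = ((rGamma s)^-1 * \int[mu]_(t in D) (mellin_kernel s t * Lprod J t))%:C.
Proof.
move=> s2; have s1 : 1 <= s by apply: le_trans s2; rewrite ler1n.
have [->|J0] := eqVneq J finset.set0.
  rewrite enum_set0 /= => -[_ ->]; last by rewrite /= (lt_le_trans _ s2) // ltr1n.
  rewrite riemann_zeta_real //; last exact: integrable_mellin_kernel.
  congr ((_ * _)%:C); apply: eq_Rintegral => t _.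
  by rewrite /Lprod big_set0 mulr1.
rewrite /is_xiMT; case ksE : map => [|k ks].
  case/set0Pn: J0 => j; rewrite -mem_enum.
  by move/(map_f (fun j => ones_index (r j))); rewrite ksE.
rewrite -ksE => -[_ ->]; last first.
  by apply: (@le_lt_trans _ _ 1); rewrite ?gerBl //= (lt_le_trans _ s2) // ltr1n.
rewrite /xiMT_integral Gamma_real // (@cint0oo_real _ _ (fun t => mellin_kernel s t * Lprod J t)).
  by rewrite rmorphM fmorphV.
move=> t t0; rewrite big_map big_enum /= -rmorphB /= cpow_real.
rewrite /mellin_kernel Liexp0 // /Lprod !rmorphM /= rmorph_prod /= fmorphV; congr (_ * _).
by apply: eq_bigr => j _; rewrite L_MT_ones.
Qed.

End RealPoints.

(** * From real s to meromorphic functions *)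

Lemma mero_at_entire (K : numFieldType) (f : K -> K) z0 : entire f -> mero_at f z0.
Proof. by move=> ef; apply: meromorphic_mero_at => z; left; exact: ef. Qed.

Lemma mero_atB (K : numFieldType) (f g : K -> K) z0 :
  mero_at f z0 -> mero_at g z0 -> mero_at (fun z => f z - g z) z0.
Proof.
move=> fm gm; rewrite (_ : (fun _ => _) = fun z => f z + -1 * g z).
  by apply: mero_atD => //; exact: mero_atZ.
by apply/funext => z; rewrite mulN1r.
Qed.

Lemma is_xiMT_mero_at (R : realType) ks (X : R[i] -> R[i]) (z : R[i]) :
  is_xiMT ks X -> mero_at (K := R[i]) X z.
Proof.
rewrite /is_xiMT; case: ks => [|k ks] [Xm _]; last exact: mero_at_entire.
exact: meromorphic_mero_at.
Qed.

Local Close Scope classical_set_scope.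

Theorem theorem15 (R : realType)
  (xiMT : seq mt_index -> R[i] -> R[i])
  (zetaMT : seq nat -> R[i] -> R[i])
  (xiMT_P : forall ks : seq mt_index, all mt_index_valid ks ->
     is_xiMT ks (xiMT ks))
  (zetaMT_P : forall k : seq nat, (0 < size k)%N -> is_zetaMT k (zetaMT k))
  (N : nat) (N_gt0 : (0 < N)%N)
  (r : 'I_N.-1 -> nat) (r_gt0 : forall j, (0 < r j)%N) :
  let wt := (\sum_j r j)%N in
  mero_eq
    (fun s : R[i] =>
       \sum_(0 <= n < N) (-1) ^+ n *
         \sum_(J : {set 'I_N.-1} | #|J| == n)
           (\prod_(j in ~: J) zetaMT_series (nseq (r j) 1%N) 1) *
           xiMT [seq ones_index (r j) | j <- enum J] s)
    (fun s : R[i] =>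
       \sum_(0 <= n < wt.+1) poch s n *
         \sum_(i : {ffun 'I_N.-1 -> 'I_wt.+1} |
               [forall l, (i l <= r l)%N] && ((\sum_l i l)%N == n))
           (\prod_j ('C(r j, i j) * (r j - i j)`!)%N%:R) *
           zetaMT (rcons [seq (r j - i j + 1)%N | j <- enum 'I_N.-1] 0%N)
             (s + n%:R)).
Proof.
move=> wt0.
have xiP (J : {set 'I_N.-1}) : is_xiMT [seq ones_index (r j) | j <- enum J]
    (xiMT [seq ones_index (r j) | j <- enum J]).
  apply: xiMT_P; rewrite all_map; apply/allP => j _ /=.
  by rewrite /mt_index_valid /= size_nseq r_gt0 all_nseq orbT.
have zetaP (i : {ffun 'I_N.-1 -> 'I_wt0.+1}) :
    is_zetaMT (rcons [seq (r j - i j + 1)%N | j <- enum 'I_N.-1] 0%N)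
      (zetaMT (rcons [seq (r j - i j + 1)%N | j <- enum 'I_N.-1] 0%N)).
  by apply: zetaMT_P; rewrite size_rcons.
(* The N-fold zeta series are available for s > N, and the kernel is integrable
   for s >= 2. *)
apply: (@mero_eq_of_real_half_line R _ _ (N%:R + 2)) => [z|s sN].
  apply: mero_atB.
    apply: mero_at_sum => n _; apply: mero_atZ.
    apply: mero_at_sum => J _; apply: mero_atZ.
    exact: is_xiMT_mero_at (xiP J).
  apply: mero_at_sum => n _; apply: mero_at_poch.
  apply: mero_at_sum => i _; apply: mero_atZ.
  apply: mero_at_shift; apply: meromorphic_mero_at.
  by have [] := zetaP i.
have s2 : 2 <= s by rewrite ltW // (le_lt_trans _ sN) // lerDr.
have s1 : 1 <= s by apply: le_trans s2; rewrite ler1n.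
have g0 : rGamma s != 0 by rewrite gt_eqF // rGamma_gt0.
have left_real : \sum_(0 <= n < N) (-1) ^+ n *
         \sum_(J : {set 'I_N.-1} | #|J| == n)
           (\prod_(j in ~: J) zetaMT_series (nseq (r j) 1%N) 1) *
           xiMT [seq ones_index (r j) | j <- enum J] s%:C =
    ((rGamma s)^-1 * \int[lebesgue_measure]_(t in `]0%R, +oo[%classic)
       (mellin_kernel s t * \prod_j MTtail (r j) t))%:C.
  rewrite -(sum_Lprod r_gt0 s2) prednK // mulr_sumr rmorph_sum.
  apply: eq_bigr => n _; rewrite mulrCA rmorphM rmorphXn /= rmorphN1.
  congr (_ * _); rewrite mulr_sumr rmorph_sum; apply: eq_bigr => J _.
  rewrite (xiMT_ones r_gt0 s2 (xiP J)) mulrCA !rmorphM rmorph_prod /=.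
  congr (_ * _); apply: eq_bigr => j _.
  by rewrite zetaMT_series_ones.
have right_real : \sum_(0 <= n < wt0.+1) poch s%:C n *
         \sum_(i : {ffun 'I_N.-1 -> 'I_wt0.+1} |
               [forall l, (i l <= r l)%N] && ((\sum_l i l)%N == n))
           (\prod_j ('C(r j, i j) * (r j - i j)`!)%N%:R) *
           zetaMT (rcons [seq (r j - i j + 1)%N | j <- enum 'I_N.-1] 0%N)
             (s%:C + n%:R) =
    ((rGamma s)^-1 * \int[lebesgue_measure]_(t in `]0%R, +oo[%classic)
       (mellin_kernel s t * \prod_j MTtail (r j) t))%:C.
  rewrite -(sum_Liprod r_gt0 s2) mulr_sumr rmorph_sum.
  apply: eq_bigr => n _; rewrite mulr_sumr mulr_sumr rmorph_sum.
  apply: eq_bigr => i /andP[ir /eqP <-].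
  have [_ ->] := zetaP i; last first.
    rewrite size_rcons size_map size_enum_ord prednK //.
    rewrite (_ : s%:C + _ = (s + (\sum_l i l)%N%:R)%:C); last by rewrite rmorphD /= rmorph_nat.
    by rewrite /= ltr_wpDr // (le_lt_trans _ sN) // lerDl.
  have pochC : poch s%:C (total_deg i) = (poch s (total_deg i))%:C.
    by rewrite /poch rmorph_prod; apply: eq_bigr => j _; rewrite rmorphD /= rmorph_nat.
  have coefC : \prod_j ('C(r j, i j) * (r j - i j)`!)%N%:R = (tail_coef R i)%:C.
    by rewrite /tail_coef rmorph_prod; apply: eq_bigr => j _; rewrite /= rmorph_nat.
  rewrite (zetaMT_series_Liprod r_gt0 s2 ir) -/(total_deg i) pochC coefC -!rmorphM /=.
  have gE := rGammaD_poch (total_deg i) s1.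
  have : rGamma (s + (total_deg i)%:R) != 0.
    by rewrite gt_eqF // rGamma_gt0 // (le_trans s1) // lerDl.
  rewrite gE mulf_eq0 => /norP[p0 _].
  by congr (_%:C); field; rewrite p0 g0.
by rewrite left_real right_real.
Qed.
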